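(* Let $G$ be a generalized $(m,n)$-ladder graph with paths $G_1=u_1u_2\cdots u_m$ and $G_2=v_1v_2\cdots v_n$. Then $G$ is planar if and only if for each edge $e\in[G_1,G_2]$, at least one of the following four edge sets is empty: \[L_G^{\uparrow}(e)\cap R_G^{\downarrow}(e);\quad L_G^{\uparrow}(e)\cap R_G^{\uparrow}(e);\quad L_G^{\downarrow}(e)\cap R_G^{\uparrow}(e);\quad L_G^{\downarrow}(e)\cap R_G^{\downarrow}(e).\]
   Context: All graphs are finite, undirected and simple. For positive integers $m,n$, a generalized $(m,n)$-ladder graph is a graph $G$ consisting of two vertex-disjoint paths $G_1=u_1u_2\cdots u_m$ and $G_2=v_1v_2\cdots v_n$ together with some (possibly none) edges each of which joins a vertex of $G_1$ and a vertex of $G_2$; there are no other vertices or edges. Let $[G_1,G_2]$ denote the set of edges of $G$ joining a vertex of $G_1$ to a vertex of $G_2$. For $e\in[G_1,G_2]$, let $l(e)$ be the index $i$ of its end $u_i$ on $G_1$ and $r(e)$ the index $j$ of its end $v_j$ on $G_2$. Define $L_G^{\uparrow}(e)=\{e'\in[G_1,G_2]: l(e)<l(e')\le m\}$, $L_G^{\downarrow}(e)=\{e'\in[G_1,G_2]: 1\le l(e')<l(e)\}$, $R_G^{\uparrow}(e)=\{e'\in[G_1,G_2]: r(e)<r(e')\le n\}$, $R_G^{\downarrow}(e)=\{e'\in[G_1,G_2]: 1\le r(e')<r(e)\}$. *)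

(* Defs.v *)
From mathcomp Require Import all_boot all_order all_algebra.
From mathcomp Require Import all_classical all_reals all_analysis.
Set Implicit Arguments.
Unset Strict Implicit.
Unset Printing Implicit Defensive.
Import Order.TTheory GRing.Theory Num.Theory.
Import numFieldNormedType.Exports.

Record sgraph := SGraph {
  vertex :> finType;
  adj : rel vertex;
  adj_sym : symmetric adj;
  adj_irr : irreflexive adj }.

Definition edges (G : sgraph) : {set {set G}} :=
  [set [set p.1; p.2]%SET | p in [set p : G * G | adj p.1 p.2]%SET]%SET.

Section Planarity.
Local Open Scope ring_scope.
Local Open Scope classical_set_scope.

(* [A] is a simple arc of the Euclidean plane with ends [p] and [q]: the image
   of an injective continuous map on the closed unit interval. The product
   topology on R * R is the Euclidean one. *)
Definition arc_between (R : realType) (p q : R * R) (A : set (R * R)) : Prop :=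
  exists g : R -> R * R,
    [/\ {within `[0, 1], continuous g}, {in `[0, 1] &, injective g},
        g 0 = p, g 1 = q & g @` `[0, 1] = A].

(* Crossing-free drawing in the plane: distinct vertices are distinct points,
   edges are simple arcs joining their ends and passing through no other
   vertex, and two distinct edges meet at most in their common ends. *)
Definition planar_drawing (R : realType) (G : sgraph)
    (pos : G -> R * R) (arc : {set G} -> set (R * R)) : Prop :=
  [/\ injective pos,
      forall x y : G, adj x y ->
        arc_between (pos x) (pos y) (arc [set x; y]%SET),
      forall (e : {set G}) (z : G), e \in edges G -> arc e (pos z) -> z \in e
    & forall e f : {set G}, e \in edges G -> f \in edges G -> e <> f ->
        arc e `&` arc f `<=` [set pos z | z in [set z | z \in (e :&: f)%SET]]].

Definition planar (R : realType) (G : sgraph) : Prop :=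
  exists (pos : G -> R * R) (arc : {set G} -> set (R * R)),
    planar_drawing pos arc.

End Planarity.

Section Ladder.
Variables (m n : nat) (G : sgraph) (u : 'I_m -> G) (v : 'I_n -> G).

(* The k-th vertex of each path (counted from 1) is the image of the ordinal of
   value k - 1. *)
Definition generalized_ladder : Prop :=
  [/\ [/\ injective u, injective v & forall i j, u i != v j],
      forall x : G, (exists i, x = u i) \/ (exists j, x = v j),
      forall i i' : 'I_m, adj (u i) (u i') = (i.+1 == i') || (i'.+1 == i)
    & forall j j' : 'I_n, adj (v j) (v j') = (j.+1 == j') || (j'.+1 == j)].

(* In a generalized ladder an edge joining the two paths is determined by its
   two ends, so the edge u_i v_j is encoded by the pair of their positions. *)
Definition rungs : {set 'I_m * 'I_n} :=
  [set e : 'I_m * 'I_n | adj (u e.1) (v e.2)]%SET.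

Definition lidx (e : 'I_m * 'I_n) : nat := e.1.+1.
Definition ridx (e : 'I_m * 'I_n) : nat := e.2.+1.

Definition Lup (e : 'I_m * 'I_n) : {set 'I_m * 'I_n} :=
  [set e' in rungs | lidx e < lidx e' <= m]%SET.
Definition Ldown (e : 'I_m * 'I_n) : {set 'I_m * 'I_n} :=
  [set e' in rungs | 1 <= lidx e' < lidx e]%SET.
Definition Rup (e : 'I_m * 'I_n) : {set 'I_m * 'I_n} :=
  [set e' in rungs | ridx e < ridx e' <= n]%SET.
Definition Rdown (e : 'I_m * 'I_n) : {set 'I_m * 'I_n} :=
  [set e' in rungs | 1 <= ridx e' < ridx e]%SET.

End Ladder.

(* Main.v *)
Require Import Defs.
From mathcomp Require Import all_boot all_order all_algebra.
From mathcomp Require Import all_classical all_reals all_analysis.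
From mathcomp Require Import ring lra zify.
From Stdlib Require Import Btauto.

(** Necessity. Suppose that each quadrant of a rung u_i v_j contains a rung.
    Contracting the pieces of the two paths before and after u_i and v_j gives
    a K_{3,3}, so nine continua of the plane would join the vertices of two
    triples in such a way that two continua without a common end are disjoint.
    To refute this, replace the continua by polygonal chains of small mesh and
    let U(p, c) be the parity of the number of segments of the chain c above
    the point p. For disjoint chains c from a to b and c' from a' to b',
    U(a, c') + U(b, c') + U(a', c) + U(b', c) is determined by the horizontal
    order of the four ends. Summing over the 18 pairs of nonadjacent edges of
    K_{3,3}, every U occurs twice whereas the order terms add up to 1.

    Sufficiency. Squaring complex numbers maps the closed upper half-plane onto
    the plane, identifying only (x, 0) and (-x, 0). So v_j may be put at both
    (j, 0) and (-j, 0). Put the first path on the two slopes of a roof, the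
    left one rising and the right one falling. A rung is a straight segment
    which, according to its empty quadrant, reaches the left slope from outside
    (no rung to the upper left), the right slope from outside (upper right), or
    comes from below the roof with its foot on the right (lower right) or on
    the left (lower left). In each of these classes, the empty quadrants say
    that rungs are ordered monotonically, hence do not cross. *)

Set Implicit Arguments.
Unset Strict Implicit.
Unset Printing Implicit Defensive.
Import Order.TTheory GRing.Theory Num.Theory.
Import numFieldNormedType.Exports.

(** * Crossing parity of segments and chains *)

Section Crossings.
Local Open Scope ring_scope.
Local Open Scope classical_set_scope.
Variable R : realType.
Implicit Types p q c d : R * R.

(* Replacing abscissas by the lexicographic order amounts to an infinitesimal
   shear and removes the need for chains in general position. *)
Definition lexlt p q := (p.1 < q.1) || ((p.1 == q.1) && (p.2 < q.2)).

Lemma lexlt_total p q : p != q -> lexlt q p = ~~ lexlt p q.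
Proof.
case: p q => [a b] [c d]; rewrite /lexlt /= xpair_eqE.
by case: (ltgtP a c); case: (ltgtP b d).
Qed.

(** Finitely many strict inequalities between abscissas survive a small multiple of the ordinates,
    which then only breaks ties. On finitely many points the order is thus linear and open to real
    arithmetic. *)
Lemma lexlt_functional (s : seq (R * R)) : exists e : R,
  forall p q, p \in s -> q \in s ->
    lexlt p q = (p.1 + e * p.2 < q.1 + e * q.2).
Proof.
suff [e eP] : exists e : R, 0 < e /\ forall p q, p \in s -> q \in s ->
    p.1 < q.1 -> p.1 + e * p.2 < q.1 + e * q.2.
  have [e0 {}eP] := eP; exists e => p q ps qs; rewrite /lexlt.
  case: (ltgtP p.1 q.1) => [pq|qp|->] /=.
  - by rewrite eP.
  - by apply/esym/negbTE; rewrite -leNgt ltW// eP.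
  - by rewrite ltrD2l ltr_pM2l.
(* Quantifying over all positive [e'] up to [e] lets the induction shrink the bound for each new
   pair. *)
have key (l : seq ((R * R) * (R * R))) : exists e : R, 0 < e /\
    forall e', 0 < e' <= e -> forall pq, pq \in l -> pq.1.1 < pq.2.1 ->
    pq.1.1 + e' * pq.1.2 < pq.2.1 + e' * pq.2.2.
  elim: l => [|[p q] l [e [e0 IH]]]; first by exists 1; split.
  have [pq|pq] := ltP p.1 q.1; last first.
    exists e; split=> // e' he pq'; rewrite inE => /orP[/eqP->/=|]; last exact: IH.
    by rewrite ltNge pq.
  pose k := `|p.2 - q.2| + 1; have k0 : 0 < k by rewrite ltr_wpDl.
  have dk0 : 0 < (q.1 - p.1) / k by rewrite divr_gt0 // subr_gt0.
  exists (Num.min e ((q.1 - p.1) / k)); split; first by rewrite lt_min e0.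
  move=> e'; rewrite le_min => /and3P[e'0 e'e]; rewrite ler_pdivlMr // => e'k pq'.
  rewrite inE => /orP[/eqP->/=|]; last by apply: IH; rewrite e'0.
  move=> _; have := ler_norm (p.2 - q.2); rewrite /k in e'k; nra.
have [e [e0 eP]] := key [seq (p, q) | p <- s, q <- s].
exists e; split=> // p q ps qs; apply: (eP e _ (p, q)); first by rewrite e0 lexx.
by apply/allpairsP; exists (p, q).
Qed.

(** Twice the signed area of the triangle [p q r]. *)
Definition orient p q r : R :=
  (q.1 - p.1) * (r.2 - p.2) - (q.2 - p.2) * (r.1 - p.1).

Definition seg_point p q (t : R) : R * R :=
  ((1 - t) * p.1 + t * q.1, (1 - t) * p.2 + t * q.2).

Definition seg_disjoint p q c d := forall s t : R,
  0 <= s <= 1 -> 0 <= t <= 1 -> seg_point p q s <> seg_point c d t.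

(** The exclusive or makes the strip half-open, so that these bits telescope along a chain. *)
Definition between p c d := lexlt c p (+) lexlt d p.

(** It is the segment that is above: [p] lies in the strip of [c d], underneath it. [seg_below] is
    the opposite case. *)
Definition seg_above p c d :=
  between p c d && (if lexlt c d then orient c d p < 0 else 0 < orient c d p).

Definition seg_below p c d :=
  between p c d && (if lexlt c d then 0 < orient c d p else orient c d p < 0).

Lemma seg_point0 p q : seg_point p q 0 = p.
Proof. by case: p => a b; rewrite /seg_point /= subr0 !mul1r !mul0r !addr0. Qed.

Lemma seg_point1 p q : seg_point p q 1 = q.
Proof. by case: q => a b; rewrite /seg_point /= subrr !mul1r !mul0r !add0r. Qed.

Lemma seg_point_sym p q t : seg_point p q t = seg_point q p (1 - t).
Proof. by rewrite /seg_point subKr addrC [in X in (_, X)]addrC. Qed.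

Lemma seg_disjointC p q c d : seg_disjoint p q c d -> seg_disjoint c d p q.
Proof. by move=> H s t hs ht /esym; apply: H. Qed.

Lemma seg_disjoint_flip p q c d : seg_disjoint p q c d -> seg_disjoint q p c d.
Proof.
move=> H s t hs ht; rewrite seg_point_sym; apply: H => //.
by move: hs; lra.
Qed.

Lemma orientC p q r : orient q p r = - orient p q r.
Proof. rewrite /orient; ring. Qed.

Lemma seg_aboveC p c d : seg_above p c d = seg_above p d c.
Proof.
have [->//|cd] := eqVneq c d.
rewrite /seg_above (lexlt_total cd) orientC oppr_lt0 oppr_gt0 /between (addbC (lexlt c p)).
by case: (lexlt c d).
Qed.

Lemma seg_belowC p c d : seg_below p c d = seg_below p d c.
Proof.
have [->//|cd] := eqVneq c d.
rewrite /seg_below (lexlt_total cd) orientC oppr_lt0 oppr_gt0 /between (addbC (lexlt c p)).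
by case: (lexlt c d).
Qed.

Lemma seg_disjoint_neq p q c d : seg_disjoint p q c d ->
  [/\ p != c, p != d, q != c & q != d].
Proof.
move=> H; split; apply/eqP => E.
- by apply: (H 0 0); rewrite ?lexx ?ler01 ?seg_point0.
- by apply: (H 0 1); rewrite ?lexx ?ler01 ?seg_point0 ?seg_point1.
- by apply: (H 1 0); rewrite ?lexx ?ler01 ?seg_point0 ?seg_point1.
- by apply: (H 1 1); rewrite ?lexx ?ler01 ?seg_point1.
Qed.

(** The orientations satisfy [A + C = B + D] and [A p + C c = B q + D d]. Moving terms across and
    dividing by [A - B] gives one point as a convex combination of both pairs of ends. *)
Lemma seg_meet p q c d : orient c d p < orient c d q ->
  orient c d p <= 0 <= orient c d q -> orient p q d <= 0 <= orient p q c ->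
  ~ seg_disjoint p q c d.
Proof.
set B := orient c d p; set A := orient c d q.
set C := orient p q d; set D := orient p q c => BA /andP[B0 A0] /andP[C0 D0] H.
have E0 : A + C = B + D by rewrite /A /B /C /D /orient; ring.
have E1 : A * p.1 + C * c.1 = B * q.1 + D * d.1.
  by rewrite /A /B /C /D /orient; ring.
have E2 : A * p.2 + C * c.2 = B * q.2 + D * d.2.
  by rewrite /A /B /C /D /orient; ring.
have N : A - B != 0 by rewrite subr_eq0 gt_eqF.
have AB : 0 < A - B by rewrite subr_gt0.
apply: (H (- B / (A - B)) (D / (A - B))).
- rewrite divr_ge0 ?oppr_ge0 // ?ler_pdivrMr //; lra.
- rewrite divr_ge0 ?ler_pdivrMr //; lra.
have F1 : 1 - - B / (A - B) = A / (A - B) by field.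
have F2 : 1 - D / (A - B) = - C / (A - B).
  by apply: (mulIf N); rewrite mulrBl !mulfVK // mul1r; lra.
rewrite /seg_point F1 F2; congr pair.
  transitivity ((A * p.1 - B * q.1) / (A - B)); first by ring.
  by transitivity ((D * d.1 - C * c.1) / (A - B)); [congr (_ / _); lra|ring].
transitivity ((A * p.2 - B * q.2) / (A - B)); first by ring.
by transitivity ((D * d.2 - C * c.2) / (A - B)); [congr (_ / _); lra|ring].
Qed.

(* The segment [c d] can only cross the boundary of the region above [p q] along
   the vertical half-lines from [p] and [q]; its ends tell whether it does so an
   even number of times. *)
Lemma seg_parity p q c d : seg_disjoint p q c d ->
  (seg_above p c d (+) seg_above q c d) (+)
  (seg_below c p q (+) seg_below d p q) = false.
Proof.
wlog pq : p q / lexlt p q.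
  move=> W H; have [E|E] := eqVneq p q.
    by subst q; rewrite /seg_below /between !addbb.
  case/boolP: (lexlt p q) => [/W-> //|]; rewrite -lexlt_total // => /W.
  by rewrite (addbC (seg_above q c d)) !(seg_belowC _ q p); apply; apply: seg_disjoint_flip.
wlog cd : c d / lexlt c d.
  move=> W H; have [E|E] := eqVneq c d.
    by subst c; rewrite /seg_above /between !addbb.
  case/boolP: (lexlt c d) => [/W-> //|]; rewrite -lexlt_total // => /W.
  rewrite (addbC (seg_below d p q)) !(seg_aboveC _ d c); apply.
  exact/seg_disjointC/seg_disjoint_flip/seg_disjointC.
move=> H; have [pc pd qc qd] := seg_disjoint_neq H.
have Hf := seg_disjoint_flip H.
have [e eP] := lexlt_functional [:: p; q; c; d].
rewrite /seg_above /seg_below pq cd /between.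
rewrite (lexlt_total pc) (lexlt_total pd) (lexlt_total qc) (lexlt_total qd).
move: pq cd; rewrite !eP ?inE ?eqxx ?orbT //.
have M1 := @seg_meet p q c d; have M2 := @seg_meet q p c d.
have := lexlt_total pc; have := lexlt_total pd; have := lexlt_total qc.
have := lexlt_total qd; rewrite !eP ?inE ?eqxx ?orbT //.
rewrite !(orientC p q) !oppr_le0 !oppr_ge0 in M2.
have E0 : orient c d q + orient p q d = orient c d p + orient p q c.
  by rewrite /orient; ring.
have E1 : orient c d q * (p.1 + e * p.2) + orient p q d * (c.1 + e * c.2) =
   orient c d p * (q.1 + e * q.2) + orient p q c * (d.1 + e * d.2).
  by rewrite /orient; ring.
(* From here on only the orientations [A], [B], [C], [D] and the sheared abscissas [x], [y], [z],
   [w] of [p], [q], [c], [d] remain, tied by [E0] and [E1]. *)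
move: E0 E1 M1 M2 => {eP}.
move: (orient c d q) (orient c d p) (orient p q d) (orient p q c) => A B C D.
move: (p.1 + _) (q.1 + _) (c.1 + _) (d.1 + _) => x y z w E0 E1 M1 M2.
have {M1} M1 : B < A -> B <= 0 -> 0 <= A -> C <= 0 -> 0 <= D -> False.
  by move=> h1 h2 h3 h4 h5; apply: M1 H; rewrite ?h1 ?h2 ?h3 ?h4 ?h5.
have {M2} M2 : A < B -> A <= 0 -> 0 <= B -> D <= 0 -> 0 <= C -> False.
  by move=> h1 h2 h3 h4 h5; apply: M2 Hf; rewrite ?h1 ?h2 ?h3 ?h4 ?h5.
case: (ltgtP x z) => xz; case: (ltgtP x w) => xw //=;
case: (ltgtP y z) => yz; case: (ltgtP y w) => yw //= _ _ _ _ xy zw; try lra.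
(* [F1] to [F3] are [E1] with the origin of the abscissas moved to [z], [y] and [w], which exposes
   the signs of the coefficients. *)
all: have F1 : A * (z - x) = B * (z - y) + D * (z - w)
  by have := congr1 (fun u => u * z) E0; lra.
all: have F2 : A * (y - x) = C * (z - y) + D * (y - w)
  by have := congr1 (fun u => u * y) E0; lra.
all: have F3 : C * (w - z) = A * (x - w) + B * (w - y)
  by have := congr1 (fun u => u * w) E0; lra.
(* In each remaining order of the ends two bits must agree; a disagreement forces signs to which
   [M1] or [M2] applies, hence an intersection. *)
all: clear E1 H Hf pc pd qc qd; rewrite ?addbF ?addFb //=; apply/negbTE;
  rewrite negb_add; apply/eqP; apply/idP/idP => a; rewrite ltNge; apply/negP => b.
- have B0 : 0 < B by clear M1 M2; nra.
  have C0 : 0 < C by clear M1 M2; nra.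
  by apply: M2; lra.
- have C0 : C < 0 by clear M1 M2; nra.
  have B0 : B < 0 by clear M1 M2; nra.
  by apply: M1; lra.
- have B0 : B <= 0 by clear M1 M2; nra.
  have A0 : 0 <= A by clear M1 M2; nra.
  by apply: M1; lra.
- have A0 : A <= 0 by clear M1 M2; nra.
  have B0 : 0 <= B by clear M1 M2; nra.
  by apply: M2; lra.
- have C0 : C <= 0 by clear M1 M2; nra.
  have D0 : 0 <= D by clear M1 M2; nra.
  by apply: M1; lra.
- have D0 : D <= 0 by clear M1 M2; nra.
  have C0 : 0 <= C by clear M1 M2; nra.
  by apply: M2; lra.
- have A0 : 0 < A by clear M1 M2; nra.
  have D0 : 0 < D by clear M1 M2; nra.
  by apply: M1; lra.
- have D0 : D < 0 by clear M1 M2; nra.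
  have A0 : A < 0 by clear M1 M2; nra.
  by apply: M2; lra.
Qed.

(** A point of the strip collinear with [c d] divides it in the ratio given by [l], so it lies on
    the segment. The degenerate segment [p p] expresses that [p] is off [c d]. *)
Lemma seg_above_below p c d : seg_disjoint p p c d ->
  seg_above p c d (+) seg_below p c d = lexlt c p (+) lexlt d p.
Proof.
move=> H; have [pc pd _ _] := seg_disjoint_neq H.
have [->|cd] := eqVneq c d; first by rewrite /seg_above /seg_below /between addbb.
rewrite /seg_above /seg_below -/(between p c d).
suff : between p c d -> orient c d p != 0.
  by case: between => //= /(_ isT); case: lexlt; case: ltgtP.
apply: contraTneq => E; apply/negP => bet; move: H bet.
have [e eP] := lexlt_functional [:: p; c; d].
rewrite /between !eP ?inE ?eqxx ?orbT //.
set l := fun x : R * R => x.1 + e * x.2; rewrite -/(l c) -/(l p) -/(l d) => H bet.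
have dc : l d - l c != 0.
  by rewrite subr_eq0; apply: contraTneq bet => ->; rewrite addbb.
have E1 : (p.1 - c.1) * (l d - l c) = (l p - l c) * (d.1 - c.1).
  by have := congr1 (fun z => e * z) E; rewrite /orient /l mulr0; lra.
have E2 : (p.2 - c.2) * (l d - l c) = (l p - l c) * (d.2 - c.2).
  by move: E; rewrite /orient /l; lra.
apply: (H 0 ((l p - l c) / (l d - l c))); rewrite ?lexx ?ler01 //.
  case: (ltgtP (l d) (l c)) dc => [h _|h _|->]; last by rewrite subrr eqxx.
    rewrite -mulrNN -invrN !opprB.
    have h' : 0 < l c - l d by lra.
    rewrite ler_pdivrMr // ler_pdivlMr // mul0r mul1r.
    by move: bet; case: ltP; case: ltP => //=; lra.
  have h' : 0 < l d - l c by lra.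
  rewrite ler_pdivrMr // ler_pdivlMr // mul0r mul1r.
  by move: bet; case: ltP; case: ltP => //=; lra.
rewrite seg_point0 /seg_point; move: E E1 E2 {H bet pc pd eP}; case: p => x y /= E E1 E2.
congr pair; apply: (mulIf dc).
  transitivity (c.1 * (l d - l c) + (l (x, y) - l c) * (d.1 - c.1)); first lra.
  by field.
transitivity (c.2 * (l d - l c) + (l (x, y) - l c) * (d.2 - c.2)); first lra.
by field.
Qed.
End Crossings.

(** * Parity for polygonal chains and the contradiction for K_{3,3} *)

Section Chains.
Local Open Scope ring_scope.
Local Open Scope classical_set_scope.
Variable R : realType.
Implicit Types (p q c d x y : R * R) (r s : seq (R * R)) (E F : rel (R * R)).

Fixpoint chain_above p x s :=
  if s is y :: s' then seg_above p x y (+) chain_above p y s' else false.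

Fixpoint chain_below p x s :=
  if s is y :: s' then seg_below p x y (+) chain_below p y s' else false.

Lemma chain_seg_parity F p q x s : path F x s ->
  (forall c d, F c d -> seg_disjoint p q c d) ->
  (chain_above p x s (+) chain_above q x s) (+)
  (seg_below x p q (+) seg_below (last x s) p q) = false.
Proof.
move=> + H; elim: s x => [x _|y s IH x /= /andP[/H/seg_parity + /IH]].
  by rewrite /= addbb.
by case: seg_above; case: seg_above; case: seg_below; case: seg_below;
   case: chain_above; case: chain_above; case: seg_below.
Qed.

(** Summing [seg_parity] over all pairs of segments counts every inner vertex of either chain twice,
    so only the four ends remain. *)
Lemma chain_parity E F p r x s : path E p r -> path F x s ->
  (forall p q c d, E p q -> F c d -> seg_disjoint p q c d) ->
  (chain_above p x s (+) chain_above (last p r) x s) (+)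
  (chain_below x p r (+) chain_below (last x s) p r) = false.
Proof.
move=> Er Fs H; elim: r p Er => [p _|q r IH p /= /andP[Epq /IH]].
  by rewrite /= addbb.
have := chain_seg_parity Fs (fun c d => @H p q c d Epq).
by do 2 case: (chain_above _ _ _); case: (chain_above _ _ _);
   do 2 case: (seg_below _ _ _); do 2 case: (chain_below _ _ _).
Qed.

Lemma chain_above_below F p x s : path F x s ->
  (forall c d, F c d -> seg_disjoint p p c d) ->
  chain_above p x s (+) chain_below p x s = lexlt x p (+) lexlt (last x s) p.
Proof.
move=> + H; elim: s x => [x _|y s IH x /= /andP[/H/seg_above_below + /IH]].
  by rewrite /= addbb.
by case: seg_above; case: seg_below; case: chain_above; case: chain_below;
   do 3 case: (lexlt _ _).
Qed.

Lemma k33_chains (a b : 'I_3 -> R * R) (r : 'I_3 -> 'I_3 -> seq (R * R))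
    (E : 'I_3 -> 'I_3 -> rel (R * R)) :
  (forall k l, path (E k l) (a k) (r k l)) ->
  (forall k l, last (a k) (r k l) = b l) ->
  (forall k l, E k l (a k) (a k)) -> (forall k l, E k l (b l) (b l)) ->
  (forall k l k' l', k != k' -> l != l' -> forall p q c d,
     E k l p q -> E k' l' c d -> seg_disjoint p q c d) ->
  False.
Proof.
move=> Er rb Ea Eb dis.
pose A k k' l' := chain_above (a k) (a k') (r k' l').
pose B l k' l' := chain_above (b l) (a k') (r k' l').
(* [L] is the sum in [chain_parity] with each [chain_below] traded for [chain_above] and order terms
   by [chain_above_below]. *)
pose L k l k' l' :=
    A k k' l' (+) B l k' l' (+) A k' k l (+) B l' k l (+)
    lexlt (a k) (a k') (+) lexlt (b l) (a k') (+)
    lexlt (a k) (b l') (+) lexlt (b l) (b l').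
have H k l k' l' : k != k' -> l != l' -> L k l k' l' = false.
  move=> kk ll; rewrite /L; have D := dis _ _ _ _ kk ll.
  have := chain_parity (Er k l) (Er k' l') D.
  have Da : forall c d, E k l c d -> seg_disjoint (a k') (a k') c d.
    by move=> c d /D/(_ (Ea k' l'))/seg_disjointC.
  have Db : forall c d, E k l c d -> seg_disjoint (b l') (b l') c d.
    by move=> c d /D/(_ (Eb k' l'))/seg_disjointC.
  have := chain_above_below (Er k l) Da; have := chain_above_below (Er k l) Db.
  rewrite !rb -/(A k k' l') -/(A k' k l) -/(B l k' l') -/(B l' k l).
  case: (A k k' l'); case: (A k' k l); case: (B l k' l'); case: (B l' k l);
  do 4 case: (lexlt _ _);
  do 2 case: (chain_below _ _ _) => //.
have bneq l l' : l != l' -> lexlt (b l') (b l) = ~~ lexlt (b l) (b l').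
  move=> ll; apply: lexlt_total.
  have D := @dis ord0 l (lift ord0 ord0) l' isT ll.
  by have [] := seg_disjoint_neq (D _ _ _ _ (Eb _ _) (Eb _ _)).
pose o0 : 'I_3 := ord0; pose o1 : 'I_3 := lift ord0 ord0; pose o2 : 'I_3 := ord_max.
have addb_xorb e f : e (+) f = xorb e f by case: e; case: f.
(* The 18 terms are those with [k < k'] and [l != l']. All cancels except the order of the [b]
   points: each of their three pairs contributes 1 for each of the three pairs of [a] points, nine
   in all. *)
have : L o0 o0 o1 o1 (+)
    L o0 o0 o1 o2 (+)
    L o0 o1 o1 o0 (+)
    L o0 o1 o1 o2 (+)
    L o0 o2 o1 o0 (+)
    L o0 o2 o1 o1 (+)
    L o0 o0 o2 o1 (+)
    L o0 o0 o2 o2 (+)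
    L o0 o1 o2 o0 (+)
    L o0 o1 o2 o2 (+)
    L o0 o2 o2 o0 (+)
    L o0 o2 o2 o1 (+)
    L o1 o0 o2 o1 (+)
    L o1 o0 o2 o2 (+)
    L o1 o1 o2 o0 (+)
    L o1 o1 o2 o2 (+)
    L o1 o2 o2 o0 (+)
    L o1 o2 o2 o1 = true.
  rewrite /L (bneq o0 o1 isT) (bneq o0 o2 isT) (bneq o1 o2 isT) !addb_xorb.
  btauto.
by rewrite !H.
Qed.
End Chains.

(** * Topological nonplanarity of K_{3,3} *)

Section Continua.
Local Open Scope ring_scope.
Local Open Scope classical_set_scope.
Variable R : realType.
Implicit Types (p q c d x y : R * R) (s : seq (R * R)) (A B : set (R * R)).

Definition step A (e : R) p q := `[< [/\ A p, A q & ball p e q] >].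

(** The points of [A] reachable from [p] by steps shorter than [e] within [A] form a nonempty subset
    that is open and closed in [A]. *)
Lemma connected_chain A (e : R) p q : connected A -> 0 < e -> A p -> A q ->
  exists s, path (step A e) p s /\ last p s = q.
Proof.
move=> cA e0 Ap Aq.
pose B := [set x | A x /\ exists s, path (step A e) p s /\ last p s = x].
suff : B = A by move=> BA; have [] : B q by rewrite BA.
have stepB x y : B x -> A y -> ball x e y -> B y.
  move=> [Ax [s [ps lx]]] Ay xy; split=> //; exists (rcons s y).
  by rewrite last_rcons rcons_path ps lx; split=> //=; apply/asboolP.
apply: cA.
- by exists p; split=> //; exists [::].
- exists (\bigcup_(x in B) (ball x e)°); first by apply: bigcup_open => x _; exact: open_interior.
  apply/seteqP; split=> [x Bx|x [Ax [y By /interior_subset xy]]]; last exact: stepB By Ax xy.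
  by split; [case: Bx|exists x => //; exact: nbhsx_ballx].
- exists (~` \bigcup_(x in A `\` B) (ball x e)°).
    by apply: open_closedC; apply: bigcup_open => x _; exact: open_interior.
  apply/seteqP; split=> [x Bx|x [Ax nx]].
    split; first by case: Bx.
    by move=> [y [Ay nBy] /interior_subset/ball_sym yx]; apply: nBy; exact: stepB Bx Ay yx.
  apply: contrapT => nBx; apply: nx; exists x => //; exact: nbhsx_ballx.
Qed.

(** Each [p] in [A] has a ball of some radius [r] missing the closed set [B]; half of it serves all
    nearby points and all [e < r / 2]. Compactness of [A] makes this uniform. *)
Lemma compact_separated A B : compact A -> compact B -> A `&` B = set0 ->
  \forall e \near (0:R)^'+, forall p q, A p -> B q -> ~ ball p e q.
Proof.
move=> cA cB AB.
have clB : closed B by apply: compact_closed => //; exact: norm_hausdorff.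
suff : \forall e \near (0:R)^'+, A `<=` (fun p => forall q, B q -> ~ ball p e q).
  by apply: filterS => e H p q /H; apply.
apply: (proj1 (compact_near_coveringP A) cA) => p Ap.
have : nbhs p (~` B).
  by apply: open_nbhs_nbhs; split; [exact: closed_openC|move=> Bp; have : (A `&` B) p by []; rewrite AB].
move=> /nbhs_ballP[r /= r0 rB].
have r2 : 0 < r / 2 by rewrite divr_gt0.
exists (ball p (r / 2), [set e : R | e < r / 2]) => /=.
  split; first exact: nbhsx_ballx.
  by near=> e; near: e; exact: nbhs_right_lt.
move=> [x e] /= [px er] q Bq xq; apply: (rB q) Bq.
rewrite (splitr r); apply: ball_triangle px _.
by apply: le_ball xq; exact: ltW.
Unshelve. all: by end_near.
Qed.

Lemma ball_seg_point p q (e t : R) : 0 < e -> 0 <= t <= 1 -> ball p e q ->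
  ball p e (seg_point p q t).
Proof.
move=> e0 /andP[t0 t1] [/= h1 h2]; have key (x y : R) : ball x e y ->
    ball x e ((1 - t) * x + t * y).
  rewrite /ball /= !ltr_norml => /andP[xy yx]; apply/andP; split; nra.
by split; apply: key.
Qed.

(** A common point would be within [e] of both [p] and [c], bringing these closer than [e + e]. *)
Lemma step_disjoint A B (e : R) p q c d : 0 < e ->
  (forall x y, A x -> B y -> ~ ball x (e + e) y) ->
  step A e p q -> step B e c d -> seg_disjoint p q c d.
Proof.
move=> e0 AB /asboolP[Ap _ pq] /asboolP[Bc _ cd] s t hs ht E.
apply: (AB p c Ap Bc); apply: ball_triangle (ball_seg_point e0 hs pq) _.
by rewrite E; apply/ball_sym/ball_seg_point.
Qed.

Lemma k33_continua (a b : 'I_3 -> R * R) (C : 'I_3 -> 'I_3 -> set (R * R)) :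
  (forall k l, connected (C k l)) -> (forall k l, compact (C k l)) ->
  (forall k l, C k l (a k)) -> (forall k l, C k l (b l)) ->
  (forall k l k' l', k != k' -> l != l' -> C k l `&` C k' l' = set0) ->
  False.
Proof.
move=> connC compC Ca Cb dis.
have [e [e0 sep]] : exists e : R, 0 < e /\ forall k l k' l', k != k' -> l != l' ->
    forall x y, C k l x -> C k' l' y -> ~ ball x (e + e) y.
  have : \forall e \near (0:R)^'+, forall k l k' l', k != k' -> l != l' ->
      forall x y, C k l x -> C k' l' y -> ~ ball x e y.
    apply: filter_forall => k; apply: filter_forall => l.
    apply: filter_forall => k'; apply: filter_forall => l'.
    have [->|kk] := eqVneq k k'; first by near=> e.
    have [->|ll] := eqVneq l l'; first by near=> e.
    have := compact_separated (compC k l) (compC k' l') (dis _ _ _ _ kk ll).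
    by apply: filterS => e + _ _.
  (* [H] covers the positive numbers strictly below [r]; with this choice [e + e] is [r / 2]. *)
  move=> [r /= r0 H]; exists (r / 2 / 2).
  split; first by rewrite !divr_gt0.
  move=> k l k' l' kk ll x y; rewrite -splitr; apply: H => //=.
    by rewrite sub0r normrN gtr0_norm ?divr_gt0 // ltr_pdivrMr// ltr_pMr// ltr1n.
  by rewrite divr_gt0.
have chain k l : {s | path (step (C k l) e) (a k) s /\ last (a k) s = b l}.
  by apply: cid; apply: connected_chain.
apply: (@k33_chains R a b (fun k l => sval (chain k l)) (fun k l => step (C k l) e)).
- by move=> k l; case: (svalP (chain k l)).
- by move=> k l; case: (svalP (chain k l)).
- by move=> k l; apply/asboolP; split=> //; exact: ballxx.
- by move=> k l; apply/asboolP; split=> //; exact: ballxx.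
- move=> k l k' l' kk ll p q c d; apply: step_disjoint => //; exact: sep.
Unshelve. all: by end_near.
Qed.
End Continua.

Section Arcs.
Local Open Scope ring_scope.
Local Open Scope classical_set_scope.
Variable R : realType.
Implicit Types (p q : R * R) (A : set (R * R)).

Lemma arc_between_connected p q A : arc_between p q A -> connected A.
Proof.
by move=> [g [cg _ _ _ <-]]; apply: connected_continuous_connected cg; exact: segment_connected.
Qed.

Lemma arc_between_compact p q A : arc_between p q A -> compact A.
Proof.
by move=> [g [cg _ _ _ <-]]; apply: continuous_compact cg _; exact: segment_compact.
Qed.

Lemma arc_between_ends p q A : arc_between p q A -> A p /\ A q.
Proof.
move=> [g [_ _ <- <- <-]]; split; [exists 0|exists 1] => //=;
by rewrite in_itv /= lexx ler01.
Qed.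

End Arcs.

(** * Planar graphs have no K_{3,3} minor *)

Section NonPlanar.
Local Open Scope ring_scope.
Local Open Scope classical_set_scope.
Variables (R : realType) (G : sgraph).

Section Trail.
Variables (pos : G -> R * R) (arc : {set G} -> set (R * R)).
Hypothesis drawing : planar_drawing pos arc.

Fixpoint trail (x : G) (s : seq G) : set (R * R) :=
  if s is y :: s' then arc [set x; y]%SET `|` trail y s' else [set pos x].

Lemma trail_head x s : path (@adj G) x s -> trail x s (pos x).
Proof.
case: s => [//|y s /= /andP[xy _]]; left.
by have [_ H _ _] := drawing; have [] := arc_between_ends (H _ _ xy).
Qed.

Lemma trail_last x s : path (@adj G) x s -> trail x s (pos (last x s)).
Proof. by elim: s x => [//|y s IH x /= /andP[_ /IH ?]]; right. Qed.

Lemma trail_compact x s : path (@adj G) x s -> compact (trail x s).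
Proof.
elim: s x => [x _|y s IH x /= /andP[xy /IH cs]]; first exact: compact_set1.
apply: compactU cs; have [_ H _ _] := drawing.
exact: arc_between_compact (H _ _ xy).
Qed.

Lemma trail_connected x s : path (@adj G) x s -> connected (trail x s).
Proof.
elim: s x => [x _|y s IH x /= /andP[xy ys]]; first exact: connected1.
have [_ H _ _] := drawing; have Hxy := H _ _ xy.
apply: connectedU (arc_between_connected Hxy) (IH _ ys).
by exists (pos y); split; [case: (arc_between_ends Hxy)|exact: trail_head].
Qed.

Lemma trail_sub x s w : path (@adj G) x s -> trail x s w ->
  (exists2 z, z \in x :: s & w = pos z) \/
  exists y z, [/\ y \in x :: s, z \in x :: s, adj y z & arc [set y; z]%SET w].
Proof.
elim: s x => [x _ ->|y s IH x /= /andP[xy ys] [w_xy|/(IH _ ys)]].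
- by left; exists x; rewrite ?inE.
- by right; exists x, y; rewrite !inE !eqxx orbT.
- case=> [[z zs ->]|[z [t [zs ts zt wzt]]]]; [left|right].
    by exists z; rewrite // inE zs orbT.
  by exists z, t; rewrite !(inE, zs, ts) ?orbT; split; rewrite // -in_cons ?zs ?ts orbT.
Qed.

Lemma edge_adj (x y : G) : adj x y -> [set x; y]%SET \in edges G.
Proof. by move=> xy; apply/imsetP; exists (x, y); rewrite ?inE. Qed.

(** Walks without a common vertex have no common edge, and arcs of distinct edges meet only at
    common ends. *)
Lemma trail_disjoint x s y t : path (@adj G) x s -> path (@adj G) y t ->
  (forall z, z \in x :: s -> z \in y :: t -> False) ->
  trail x s `&` trail y t = set0.
Proof.
move=> xs yt dis; apply/seteqP; split=> // w [].
have [pinj _ arcpos arcs] := drawing.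
have arc_pos z z1 z2 : adj z1 z2 -> arc [set z1; z2]%SET (pos z) -> z = z1 \/ z = z2.
  by move=> /edge_adj e /(arcpos _ _ e); rewrite !inE => /orP[]/eqP; [left|right].
move=> /(trail_sub xs) + /(trail_sub yt).
case=> [[z zs ->]|[z1 [z2 [z1s z2s z12 w12]]]].
  case=> [[z' z's /pinj zz']|[z3 [z4 [z3s z4s z34 w34]]]].
    by apply: (dis z) => //; rewrite zz'.
  by have [E|E] := arc_pos _ _ _ z34 w34; apply: (dis z) => //; rewrite E.
case=> [[z' z's E]|[z3 [z4 [z3s z4s z34 w34]]]].
  by move: w12; rewrite E => w12; have [E'|E'] := arc_pos _ _ _ z12 w12;
     apply: (dis z') => //; rewrite E'.
have ne : [set z1; z2]%SET <> [set z3; z4]%SET.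
  move=> /setP/(_ z1); rewrite !inE eqxx => /esym/orP[]/eqP E;
  by apply: (dis z1) => //; rewrite E.
have [z] := arcs _ _ (edge_adj z12) (edge_adj z34) ne w (conj w12 w34).
rewrite /= !inE => /andP[/orP[]/eqP-> /orP[]/eqP E] _;
by [apply: (dis z1) => //; rewrite E|apply: (dis z2) => //; rewrite E].
Qed.

End Trail.

(** The values of [cls] name six disjoint classes. A walk from [a k] to [b l] inside the classes
    [inl k] and [inr l] misses the one for [k'], [l'] when both indices differ, so the trails serve
    as the nine continua. *)
Lemma planar_no_k33 (cls : G -> 'I_3 + 'I_3) (a b : 'I_3 -> G) :
  (forall k l, connect (fun x y => [&& adj x y, cls x \in [:: inl k; inr l]
                                     & cls y \in [:: inl k; inr l]]) (a k) (b l)) ->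
  (forall k, cls (a k) = inl k) -> (forall l, cls (b l) = inr l) ->
  ~ planar R G.
Proof.
move=> conn ca cb [pos [arc drawing]].
have walk k l : {s | [/\ path (@adj G) (a k) s, last (a k) s = b l &
    forall z, z \in a k :: s -> cls z \in [:: inl k; inr l]]}.
  apply: cid; have /connectP[s ps ->] := conn k l; exists s; split=> //.
    by apply: sub_path ps => x y /and3P[].
  move=> z; rewrite inE => /orP[/eqP->|]; first by rewrite ca inE eqxx.
  elim: s (a k) ps => // y s IH x /= /andP[/and3P[_ _ cy] ys].
  by rewrite inE => /orP[/eqP->//|]; exact: IH ys.
pose s k l := sval (walk k l).
have sP k l : path (@adj G) (a k) (s k l) by case: (svalP (walk k l)).
apply: (@k33_continua R (pos \o a) (pos \o b) (fun k l => trail pos arc (a k) (s k l))).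
- by move=> k l; exact: trail_connected.
- by move=> k l; exact: trail_compact.
- by move=> k l; exact: trail_head.
- move=> k l; have E : b l = last (a k) (s k l) by case: (svalP (walk k l)).
  by rewrite /= E; exact: trail_last.
- move=> k l k' l' kk ll; apply: trail_disjoint => // z.
  have [_ _ H] := svalP (walk k l); have [_ _ H'] := svalP (walk k' l').
  move=> /H zkl /H'; move: zkl; rewrite !inE.
  case: (cls z) => o /orP[]/eqP // [->] /orP[]/eqP // [] E.
    by rewrite E eqxx in kk.
  by rewrite E eqxx in ll.
Qed.
End NonPlanar.

Section LadderVertices.
Variables (m n : nat) (G : sgraph) (u : 'I_m -> G) (v : 'I_n -> G).
Hypothesis hG : generalized_ladder u v.

Lemma ladder_decode : exists D : G -> 'I_m + 'I_n,
  [/\ forall i, D (u i) = inl i, forall j, D (v j) = inr j &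
      forall x, x = match D x with inl i => u i | inr j => v j end].
Proof.
have [[uinj vinj uv] cover _ _] := hG.
have dec x : {d : 'I_m + 'I_n | x = match d with inl i => u i | inr j => v j end}.
  by apply: cid; case: (cover x) => -[i ->]; [exists (inl i)|exists (inr i)].
exists (fun x => sval (dec x)); split=> [i|j|x]; last exact: svalP (dec x).
  case: (dec _) => -[i'|j] /=; first by move=> /uinj->.
  by move=> /eqP; rewrite (negbTE (uv _ _)).
case: (dec _) => -[i|j'] /=; last by move=> /vinj->.
by move=> /eqP; rewrite eq_sym (negbTE (uv _ _)).
Qed.

End LadderVertices.

Lemma connect_along (G : sgraph) (X : pred G) (p : nat) (w : 'I_p -> G)
    (k k' : 'I_p) :
  (forall i i' : 'I_p, i.+1 == i' -> adj (w i) (w i')) ->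
  (forall t : 'I_p, (k <= t <= k') || (k' <= t <= k) -> X (w t)) ->
  connect (fun x y => [&& adj x y, X x & X y]) (w k) (w k').
Proof.
move=> wadj; wlog : k k' / k <= k'.
  move=> W H; case/orP: (leq_total k k') => kk; first exact: W kk H.
  rewrite (@sym_connect_sym _ (fun x y => [&& adj x y, X x & X y])).
    by apply: W kk _ => t; rewrite orbC; exact: H.
  by move=> x y; rewrite adj_sym (andbC (X x)).
move: k' => [k' lk'] /=; elim: k' lk' => [|k' IH] lk' kk H.
  have -> : k = Ordinal lk' by apply: val_inj => /=; lia.
  exact: connect0.
have [E|ne] := eqVneq (k : nat) k'.+1.
  have -> : k = Ordinal lk' by apply: val_inj.
  exact: connect0.
have lk'' : k' < p by lia.
apply: (@connect_trans _ _ (w (Ordinal lk''))).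
  by apply: IH; [lia|move=> t /= ht; apply: H => /=; lia].
by apply: connect1; rewrite wadj //= !H //=; lia.
Qed.

(** * A rung with four occupied quadrants *)

Section CrossedRung.
Variables (R : realType) (m n : nat) (G : sgraph) (u : 'I_m -> G) (v : 'I_n -> G).
Hypothesis hG : generalized_ladder u v.

(** Of the nine connections, four run through the rungs in the quadrants, one is [e] itself, and
    four are path edges at the ends of [e]. *)
Lemma crossed_rung_not_planar (e e1 e2 e3 e4 : 'I_m * 'I_n) : planar R G ->
  e \in rungs u v -> e1 \in rungs u v -> e2 \in rungs u v ->
  e3 \in rungs u v -> e4 \in rungs u v ->
  e.1 < e1.1 -> e1.2 < e.2 -> e.1 < e2.1 -> e.2 < e2.2 ->
  e3.1 < e.1 -> e.2 < e3.2 -> e4.1 < e.1 -> e4.2 < e.2 -> False.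
Proof.
case: e e1 e2 e3 e4 => [i j] [i1 j1] [i2 j2] [i3 j3] [i4 j4] + + + + + + /=.
rewrite !inE /= => P r r1 r2 r3 r4 ii1 j1j ii2 jj2 i3i jj3 i4i j4j.
have [D [Du Dv _]] := ladder_decode hG; have [_ _ uadj vadj] := hG.
pose o0 : 'I_3 := ord0; pose o1 : 'I_3 := lift ord0 ord0; pose o2 : 'I_3 := ord_max.
(* The triples of K_{3,3} are: the [v_k] before [v_j], [u_i], the [v_k] after
   [v_j]; and the [u_k] before [u_i], [v_j], the [u_k] after [u_i]. *)
pose cls z : 'I_3 + 'I_3 := match D z with
  | inl k => if k < i then inr o0 else if k == i then inl o1 else inr o2
  | inr k => if k < j then inl o0 else if k == j then inr o1 else inl o2 end.
have clsu0 (k : 'I_m) : k < i -> cls (u k) = inr o0 by rewrite /cls Du => ->.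
have clsu1 : cls (u i) = inl o1 by rewrite /cls Du ltnn eqxx.
have clsu2 (k : 'I_m) : i < k -> cls (u k) = inr o2.
  by move=> ik; rewrite /cls Du -val_eqE /= ltnNge ltnW //= gtn_eqF.
have clsv0 (k : 'I_n) : k < j -> cls (v k) = inl o0 by rewrite /cls Dv => ->.
have clsv1 : cls (v j) = inr o1 by rewrite /cls Dv ltnn eqxx.
have clsv2 (k : 'I_n) : j < k -> cls (v k) = inl o2.
  by move=> jk; rewrite /cls Dv -val_eqE /= ltnNge ltnW //= gtn_eqF.
have lti : i.+1 < m by have := ltn_ord i1; lia.
have ltj : j.+1 < n by have := ltn_ord j2; lia.
have ltpi : i.-1 < m by lia.
have ltpj : j.-1 < n by lia.
(* The outer pieces are represented by the path neighbours of [u i] and [v j]. The rungs in the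
   quadrants ensure that these exist, so [.-1] does not truncate. *)
pose ip := Ordinal lti; pose im := Ordinal ltpi.
pose jp := Ordinal ltj; pose jm := Ordinal ltpj.
pose a (k : 'I_3) := if k == o0 then v jm else if k == o1 then u i else v jp.
pose b (k : 'I_3) := if k == o0 then u im else if k == o1 then v j else u ip.
have I3 (k : 'I_3) : [\/ k = o0, k = o1 | k = o2].
  by case: k => -[|[|[|//]]] h; [constructor 1|constructor 2|constructor 3]; apply: val_inj.
apply: (@planar_no_k33 R G cls a b _ _ _ P) => [k l|k|l].
- have ua (t t' : 'I_m) : t.+1 == t' -> adj (u t) (u t') by rewrite uadj => ->.
  have va (t t' : 'I_n) : t.+1 == t' -> adj (v t) (v t') by rewrite vadj => ->.
  (* Along the second path to an end of the rung, across it, then along the first path. *)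
  have corner (X : pred G) (s s' : 'I_n) (t t' : 'I_m) : adj (u t) (v s') ->
      (forall x : 'I_n, (s <= x <= s') || (s' <= x <= s) -> X (v x)) ->
      (forall x : 'I_m, (t <= x <= t') || (t' <= x <= t) -> X (u x)) ->
      connect (fun x y => [&& adj x y, X x & X y]) (v s) (u t').
    move=> A H1 H2; apply: connect_trans (connect_along va H1) _.
    apply: connect_trans (connect_along ua H2); apply: connect1.
    by rewrite adj_sym A H1 ?H2 ?leqnn //=; lia.
  have side (X : pred G) (w w' : G) : adj w w' -> X w -> X w' ->
      connect (fun x y => [&& adj x y, X x & X y]) w w'.
    by move=> *; apply: connect1; apply/and3P.
  have [] := I3 k => ->; have [] := I3 l => ->; rewrite /a /b /=.
  + apply: (corner (fun x => cls x \in [:: inl o0; inr o0]) _ _ _ _ r4) => x /= hx.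
      by rewrite clsv0 ?inE ?eqxx //; lia.
    by rewrite clsu0 ?inE ?eqxx ?orbT //; lia.
  + apply: (side (fun x => cls x \in [:: inl o0; inr o1])).
    * by rewrite vadj /=; lia.
    * by rewrite clsv0 ?inE ?eqxx ?orbT //=; lia.
    * by rewrite clsv1 ?inE ?eqxx ?orbT //=; lia.
  + apply: (corner (fun x => cls x \in [:: inl o0; inr o2]) _ _ _ _ r1) => x /= hx.
      by rewrite clsv0 ?inE ?eqxx //; lia.
    by rewrite clsu2 ?inE ?eqxx ?orbT //; lia.
  + apply: (side (fun x => cls x \in [:: inl o1; inr o0])).
    * by rewrite uadj /=; lia.
    * by rewrite clsu1 ?inE ?eqxx ?orbT //=; lia.
    * by rewrite clsu0 ?inE ?eqxx ?orbT //=; lia.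
  + apply: (side (fun x => cls x \in [:: inl o1; inr o1])).
    * exact: r.
    * by rewrite clsu1 ?inE ?eqxx ?orbT //=; lia.
    * by rewrite clsv1 ?inE ?eqxx ?orbT //=; lia.
  + apply: (side (fun x => cls x \in [:: inl o1; inr o2])).
    * by rewrite uadj /=; lia.
    * by rewrite clsu1 ?inE ?eqxx ?orbT //=; lia.
    * by rewrite clsu2 ?inE ?eqxx ?orbT //=; lia.
  + apply: (corner (fun x => cls x \in [:: inl o2; inr o0]) _ _ _ _ r3) => x /= hx.
      by rewrite clsv2 ?inE ?eqxx //; lia.
    by rewrite clsu0 ?inE ?eqxx ?orbT //; lia.
  + apply: (side (fun x => cls x \in [:: inl o2; inr o1])).
    * by rewrite vadj /=; lia.
    * by rewrite clsv2 ?inE ?eqxx ?orbT //=; lia.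
    * by rewrite clsv1 ?inE ?eqxx ?orbT //=; lia.
  + apply: (corner (fun x => cls x \in [:: inl o2; inr o2]) _ _ _ _ r2) => x /= hx.
      by rewrite clsv2 ?inE ?eqxx //; lia.
    by rewrite clsu2 ?inE ?eqxx ?orbT //; lia.
- have [] := I3 k => ->; rewrite /a /=; [apply: clsv0 => /=; lia|by []|apply: clsv2 => /=; lia].
- have [] := I3 l => ->; rewrite /b /=; [apply: clsu0 => /=; lia|by []|apply: clsu2 => /=; lia].
Qed.
End CrossedRung.

(** * Drawing in the half-plane *)

Section Fold.
Local Open Scope ring_scope.
Variable R : realType.

(** The complex square with its imaginary part halved. *)
Definition fold (z : R * R) : R * R := (z.1 ^+ 2 - z.2 ^+ 2, z.1 * z.2).

(** The image determines [x ^+ 2 + y ^+ 2], hence both squares. As [y] is nonnegative it is known,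
    and the product fixes the sign of [x] unless [y = 0]. *)
Lemma fold_inj z w : 0 <= z.2 -> 0 <= w.2 -> fold z = fold w ->
  z = w \/ [/\ z.2 = 0, w.2 = 0 & z.1 = - w.1].
Proof.
case: z w => [x y] [x' y'] /= y0 y'0 [e1 e2].
have s : x ^+ 2 + y ^+ 2 = x' ^+ 2 + y' ^+ 2.
  apply/eqP; rewrite -(@eqrXn2 _ 2) ?addr_ge0 ?sqr_ge0 //; apply/eqP.
  transitivity ((x ^+ 2 - y ^+ 2) ^+ 2 + 4 * (x * y) ^+ 2); first by ring.
  by rewrite e1 e2; ring.
have yy : y = y'.
  by apply/eqP; rewrite -(@eqrXn2 _ 2) //; apply/eqP; lra.
subst y'; have /eqP : x ^+ 2 = x' ^+ 2 by lra.
rewrite eqf_sqr => /orP[/eqP->|/eqP E]; first by left.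
move: e2; rewrite E => /eqP; rewrite mulNr eqNr mulf_eq0 => /orP[]/eqP ->.
  by left; rewrite oppr0.
by right.
Qed.

End Fold.

(** * The roof and its rungs in the upper half-plane *)

Section Roof.
Local Open Scope ring_scope.
Variables (R : realType) (al ar : R).
Hypotheses (al0 : 0 < al) (ar0 : 0 < ar).
Implicit Types (b d s t : R).

(** One formula for both slopes: the apex [(0, 1)] is at [d = 0], the lower ends [(- al, 0)] and
    [(ar, 0)] at [d = -1] and [d = 1]. *)
Definition roof d : R * R :=
  ((ar + al) / 2 * d + (ar - al) / 2 * `|d|, 1 - `|d|).

Lemma roof_left d : d <= 0 -> roof d = (al * d, 1 + d).
Proof. by move=> d0; rewrite /roof ler0_norm //; congr pair; field. Qed.

Lemma roof_right d : 0 <= d -> roof d = (ar * d, 1 - d).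
Proof. by move=> d0; rewrite /roof ger0_norm //; congr pair; field. Qed.

Lemma roof_inj : injective roof.
Proof.
move=> d d'; case: (leP d 0) => hd; case: (leP d' 0) => hd';
rewrite ?(roof_left hd) ?(roof_left hd') ?(roof_right (ltW hd)) ?(roof_right (ltW hd'));
move=> [] e1 e2; try lra.
- by have := mulr_gt0 ar0 hd'; have := mulr_ge0_le0 (ltW al0) hd; lra.
- by have := mulr_gt0 ar0 hd; have := mulr_ge0_le0 (ltW al0) hd'; lra.
Qed.

Lemma roof_gt0 d : -1 < d < 1 -> 0 < (roof d).2.
Proof. by rewrite /= subr_gt0 ltr_norml. Qed.

Definition rung d b t := seg_point (roof d) (b, 0) t.

Definition inside b := - al < b < ar.
Definition outleft d b := (b < - al) && (d <= 0).
Definition outright d b := (ar < b) && (0 <= d).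

Lemma rung_roof d b t : rung d b t = roof d -> -1 < d < 1 -> t = 0.
Proof.
move=> [_ E] /roof_gt0; move: E => /=; set y := 1 - `|d| => E y0.
have /eqP : t * y = 0 by lra.
by rewrite mulf_eq0 (gt_eqF y0) orbF => /eqP.
Qed.

Lemma rung_foot d b t : -1 < d < 1 -> (rung d b t).2 = 0 -> t = 1.
Proof.
move=> /roof_gt0; rewrite /rung /seg_point /=; set y := 1 - `|d| => y0 E.
have /eqP : (1 - t) * y = 0 by lra.
by rewrite mulf_eq0 (gt_eqF y0) orbF => /eqP; lra.
Qed.

Lemma rung_ge0 d b t : -1 < d < 1 -> 0 <= t <= 1 -> 0 <= (rung d b t).2.
Proof.
by move=> /roof_gt0 y0 /andP[t0 t1] /=; rewrite mulr0 addr0 mulr_ge0 ?subr_ge0 // -subr_ge0 ltW.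
Qed.

(** [lside] and [rside] are affine and vanish on the lines of the left and the right slope; on the
    roof the first is nonnegative and the second nonpositive. *)
Definition lside (z : R * R) := z.1 - al * (z.2 - 1).
Definition rside (z : R * R) := z.1 + ar * (z.2 - 1).

Lemma lside_roof d : 0 <= lside (roof d).
Proof.
rewrite /lside; case: (leP d 0) => [/roof_left ->|hd]; first by rewrite /=; lra.
by rewrite (roof_right (ltW hd)) /=; have := mulr_gt0 al0 hd; have := mulr_gt0 ar0 hd; lra.
Qed.

Lemma lside_roof0 d : d <= 0 -> lside (roof d) = 0.
Proof. by move=> /roof_left; rewrite /lside => -> /=; ring. Qed.

Lemma rside_roof d : rside (roof d) <= 0.
Proof.
rewrite /rside; case: (leP d 0) => hd; last by rewrite (roof_right (ltW hd)) /=; lra.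
rewrite (roof_left hd) /=; have := mulr_ge0_le0 (ltW al0) hd.
by have := mulr_ge0_le0 (ltW ar0) hd; lra.
Qed.

Lemma rside_roof0 d : 0 <= d -> rside (roof d) = 0.
Proof. by move=> /roof_right; rewrite /rside => -> /=; ring. Qed.

Lemma lside_rung d b t :
  lside (rung d b t) = (1 - t) * lside (roof d) + t * (b + al).
Proof. rewrite /lside /rung /seg_point /=; ring. Qed.

Lemma rside_rung d b t :
  rside (rung d b t) = (1 - t) * rside (roof d) + t * (b - ar).
Proof. rewrite /rside /rung /seg_point /=; ring. Qed.

Lemma rung_0 d b : rung d b 0 = roof d.
Proof. exact: seg_point0. Qed.

Lemma rung_1 d b : rung d b 1 = (b, 0).
Proof. exact: seg_point1. Qed.

Lemma mulr_eq0_gt (x y : R) : x * y = 0 -> 0 < y -> x = 0.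
Proof. by move=> /eqP; rewrite mulf_eq0 => /orP[]/eqP // ->; rewrite ltxx. Qed.

Lemma lside_ge d b t : 0 <= t <= 1 -> - al < b -> 0 <= lside (rung d b t) /\
  (lside (rung d b t) = 0 -> t = 0).
Proof.
move=> /andP[t0 t1] ba; rewrite lside_rung; have h := lside_roof d.
have h1 : 0 <= (1 - t) * lside (roof d) by rewrite mulr_ge0 // subr_ge0.
have h2 : 0 <= t * (b + al) by rewrite mulr_ge0 //; lra.
by split; [lra|move=> E; apply: (@mulr_eq0_gt _ (b + al)); lra].
Qed.

Lemma rside_le d b t : 0 <= t <= 1 -> b < ar -> rside (rung d b t) <= 0 /\
  (rside (rung d b t) = 0 -> t = 0).
Proof.
move=> /andP[t0 t1] ba; rewrite rside_rung; have h := rside_roof d.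
have h1 : (1 - t) * rside (roof d) <= 0 by rewrite mulr_ge0_le0 // subr_ge0.
have h2 : t * (b - ar) <= 0 by rewrite mulr_ge0_le0 //; lra.
by split; [lra|move=> E; apply: (@mulr_eq0_gt _ (ar - b)); lra].
Qed.

Lemma lside_outleft d b t : 0 <= t <= 1 -> outleft d b ->
  lside (rung d b t) <= 0 /\ (lside (rung d b t) = 0 -> t = 0).
Proof.
move=> /andP[t0 t1] /andP[ba d0]; rewrite lside_rung (lside_roof0 d0) mulr0 add0r.
split; first by rewrite mulr_ge0_le0 //; lra.
by move=> E; apply: (@mulr_eq0_gt _ (- (b + al))); lra.
Qed.

Lemma rside_outright d b t : 0 <= t <= 1 -> outright d b ->
  0 <= rside (rung d b t) /\ (rside (rung d b t) = 0 -> t = 0).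
Proof.
move=> /andP[t0 t1] /andP[ba d0]; rewrite rside_rung (rside_roof0 d0) mulr0 add0r.
split; first by rewrite mulr_ge0 //; lra.
by move=> E; apply: (@mulr_eq0_gt _ (b - ar)); lra.
Qed.

Definition placed d b := [|| inside b, outleft d b | outright d b].

(** Inside rungs stay between the lines of the two slopes, outer ones beyond the line of their own
    slope, and they touch these lines at most at [t = 0]. *)
Lemma rung_meets_roof d b t s : 0 <= t <= 1 -> placed d b ->
  rung d b t = roof s -> t = 0 /\ s = d.
Proof.
move=> ht hb E; suff t0 : t = 0 by split=> //; move: E; rewrite t0 rung_0 => /roof_inj.
have L := lside_roof s; have L0 := @lside_roof0 s.
have Q := rside_roof s; have Q0 := @rside_roof0 s.
rewrite -E in L L0 Q Q0; case/or3P: hb => [/andP[b1 b2]|hb|hb].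
- have [_ h1] := lside_ge d ht b1; have [_ h2] := rside_le d ht b2.
  by case: (leP s 0) => hs; [apply/h1/L0|apply/h2/Q0/ltW].
- by have [h1 h2] := lside_outleft ht hb; apply: h2; lra.
- by have [h1 h2] := rside_outright ht hb; apply: h2; lra.
Qed.

(** The line of the left slope separates the two rungs, which can reach it only at their upper
    ends. *)
Lemma outleft_meets d b t d' b' t' : 0 <= t <= 1 -> 0 <= t' <= 1 ->
  outleft d b -> inside b' || outright d' b' ->
  rung d b t = rung d' b' t' -> [/\ t = 0, t' = 0 & d = d'].
Proof.
move=> ht ht' hb hb' E; have [h1 h2] := lside_outleft ht hb.
have b'al : - al < b'.
  case/orP: hb' => [/andP[]//|/andP[arb' _]]; apply: lt_trans arb'.
  by rewrite (@lt_trans _ _ 0) // oppr_lt0.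
have [h3 h4] := lside_ge d' ht' b'al; rewrite E in h1 h2.
have {}h2 : t = 0 by apply: h2; lra.
have {}h4 : t' = 0 by apply: h4; lra.
by split=> //; apply: roof_inj; move: E; rewrite h2 h4 !rung_0.
Qed.

Lemma outright_meets d b t d' b' t' : 0 <= t <= 1 -> 0 <= t' <= 1 ->
  outright d b -> inside b' ->
  rung d b t = rung d' b' t' -> [/\ t = 0, t' = 0 & d = d'].
Proof.
move=> ht ht' hb /andP[_ b'ar] E; have [h1 h2] := rside_outright ht hb.
have [h3 h4] := rside_le d' ht' b'ar; rewrite E in h1 h2.
have {}h2 : t = 0 by apply: h2; lra.
have {}h4 : t' = 0 by apply: h4; lra.
by split=> //; apply: roof_inj; move: E; rewrite h2 h4 !rung_0.
Qed.

(* Has the sign of the side of the line of [rung d b] on which [roof d'] lies. *)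
Definition turn d b d' :=
  ((roof d').1 - b) * (roof d).2 - (roof d').2 * ((roof d).1 - b).

(** The side function of the line of [rung d b] is affine along the other rung, from [turn d b d']
    on the roof to a positive multiple of [b' - b] at the foot. It vanishes where the rungs meet;
    both end values having the sign of [e], each weighted term is 0. *)
Lemma rung_meets_turn (e d b t d' b' t' : R) :
  -1 < d < 1 -> -1 < d' < 1 -> 0 <= t <= 1 -> 0 <= t' <= 1 ->
  0 <= e * (b' - b) -> 0 <= e * turn d b d' -> (e * turn d b d' = 0 -> d = d') ->
  e != 0 -> rung d b t = rung d' b' t' ->
  [\/ d = d' /\ b = b', [/\ t = 1, t' = 1 & b = b'] | [/\ t = 0, t' = 0 & d = d']].
Proof.
move=> hd hd' /andP[t0 t1] /andP[t'0 t'1] hb hK K0 e0 E.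
have y0 := roof_gt0 hd; have y'0 := roof_gt0 hd'.
have : e * t' * (b' - b) * (roof d).2 + (1 - t') * (e * turn d b d') = 0.
  have [E1 E2] := E; move: E1 E2; rewrite /turn /=.
  set x := _ + _ * `|d|; set y := 1 - `|d|; set x' := _ + _ * `|d'|; set y' := 1 - `|d'| => E1 E2.
  transitivity (e * (((1 - t') * x' + t' * b' - b) * y - ((1 - t') * y' + t' * 0) * (x - b))); first by ring.
  by rewrite -E1 -E2; ring.
have h1 : 0 <= e * t' * (b' - b) * (roof d).2.
  by rewrite -mulrA (mulrC e) -mulrA mulr_ge0 // mulrA mulr_ge0 // ltW.
have h2 : 0 <= (1 - t') * (e * turn d b d') by rewrite mulr_ge0 // subr_ge0.
move=> S; have {h1 S} [S1 S2] : e * t' * (b' - b) * (roof d).2 = 0 /\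
   (1 - t') * (e * turn d b d') = 0 by lra.
move: S2 => /eqP; rewrite mulf_eq0 => /orP[/eqP ht'|/eqP/K0 dd].
  have t'E : t' = 1 by lra.
  have tE : t = 1 by apply: (@rung_foot d b) => //; rewrite E t'E rung_1.
  by constructor 2; split=> //; move: E; rewrite t'E tE !rung_1 => -[].
have := mulr_eq0_gt S1 y0.
move=> /eqP; rewrite !mulf_eq0 (negbTE e0) /= => /orP[/eqP t'E|/eqP]; last first.
  by move=> ?; constructor 1; split=> //; lra.
constructor 3; split=> //; by apply: (@rung_roof d b) => //; rewrite E t'E rung_0 dd.
Qed.

Lemma inside_turn d b d' : inside b -> -1 < d < 1 -> -1 < d' < 1 -> d <= d' ->
  0 <= turn d b d' /\ (turn d b d' = 0 -> d = d').
Proof.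
move=> /andP[b1 b2] /andP[d1 d2] /andP[d'1 d'2] dd'; rewrite /turn.
case: (leP d 0) => hd; case: (leP d' 0) => hd'.
- rewrite (roof_left hd) (roof_left hd') /=.
  have -> : (al * d' - b) * (1 + d) - (1 + d') * (al * d - b) = (al + b) * (d' - d) by ring.
  split; first by rewrite mulr_ge0 //; lra.
  by rewrite mulrC => /mulr_eq0_gt; lra.
- rewrite (roof_left hd) (roof_right (ltW hd')) /=.
  have -> : (ar * d' - b) * (1 + d) - (1 - d') * (al * d - b) =
    d' * (ar - b) * (1 + d) + (- d) * (al + b) * (1 - d') by ring.
  have h1 : 0 < d' * (ar - b) * (1 + d) by rewrite !mulr_gt0 //; lra.
  have h2 : 0 <= (- d) * (al + b) * (1 - d') by rewrite !mulr_ge0 //; lra.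
  by split; lra.
- by lra.
- rewrite (roof_right (ltW hd)) (roof_right (ltW hd')) /=.
  have -> : (ar * d' - b) * (1 - d) - (1 - d') * (ar * d - b) = (ar - b) * (d' - d) by ring.
  split; first by rewrite mulr_ge0 //; lra.
  by rewrite mulrC => /mulr_eq0_gt; lra.
Qed.

Lemma outleft_turn d b d' : outleft d b -> d' <= 0 -> d <= d' ->
  0 <= - turn d b d' /\ (- turn d b d' = 0 -> d = d').
Proof.
move=> /andP[b1 hd] hd' dd'; rewrite /turn (roof_left hd) (roof_left hd') /=.
have -> : - ((al * d' - b) * (1 + d) - (1 + d') * (al * d - b)) = (- (al + b)) * (d' - d) by ring.
split; first by rewrite mulr_ge0 //; lra.
by rewrite mulrC => /mulr_eq0_gt; lra.
Qed.

Lemma outright_turn d b d' : outright d b -> 0 <= d' -> d <= d' ->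
  0 <= - turn d b d' /\ (- turn d b d' = 0 -> d = d').
Proof.
move=> /andP[b1 hd] hd' dd'; rewrite /turn (roof_right hd) (roof_right hd') /=.
have -> : - ((ar * d' - b) * (1 - d) - (1 - d') * (ar * d - b)) = (b - ar) * (d' - d) by ring.
split; first by rewrite mulr_ge0 //; lra.
by rewrite mulrC => /mulr_eq0_gt; lra.
Qed.

(** Below the roof the feet follow the order of the upper ends; outside they reverse it. *)
Definition ordered d b d' b' := [\/ [/\ inside b, inside b', b <= b' & d <= d'],
  [/\ outleft d b, outleft d' b', b' <= b & d <= d'] |
  [/\ outright d b, outright d' b', b' <= b & d <= d']].

Lemma ordered_meets d b t d' b' t' :
  -1 < d < 1 -> -1 < d' < 1 -> 0 <= t <= 1 -> 0 <= t' <= 1 ->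
  ordered d b d' b' -> rung d b t = rung d' b' t' ->
  [\/ d = d' /\ b = b', [/\ t = 1, t' = 1 & b = b'] | [/\ t = 0, t' = 0 & d = d']].
Proof.
move=> hd hd' ht ht' [] [hb hb' bb dd].
- have [h1 h2] := inside_turn hb hd hd' dd => E.
  apply: (@rung_meets_turn 1 d b t d' b' t') => //; rewrite ?mul1r ?oner_neq0 //.
  by rewrite subr_ge0.
- have [h1 h2] := outleft_turn hb (proj2 (andP hb')) dd => E.
  apply: (@rung_meets_turn (-1) d b t d' b' t') => //; rewrite ?mulN1r ?oppr_eq0 ?oner_neq0 //.
  by rewrite oppr_ge0 subr_le0.
- have [h1 h2] := outright_turn hb (proj2 (andP hb')) dd => E.
  apply: (@rung_meets_turn (-1) d b t d' b' t') => //; rewrite ?mulN1r ?oppr_eq0 ?oner_neq0 //.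
  by rewrite oppr_ge0 subr_le0.
Qed.

End Roof.

Section RealFunctions.
Local Open Scope ring_scope.
Local Open Scope classical_set_scope.

Lemma continuous_fold (R : realType) (f g : R -> R) :
  continuous f -> continuous g -> continuous (fun t => fold (f t, g t)).
Proof.
move=> cf cg t.
have cM (h k : R -> R) : continuous h -> continuous k ->
    h s * k s @[s --> t] --> h t * k t.
  by move=> ch ck; apply: cvgM; [exact: ch|exact: ck].
have h1 : f s ^+ 2 - g s ^+ 2 @[s --> t] --> f t ^+ 2 - g t ^+ 2.
  by apply: cvgB; exact: cM.
exact: (cvg_pair h1 (cM _ _ cf cg)).
Qed.

Lemma continuous_mix (R : realType) (a b : R) :
  continuous (fun t : R => (1 - t) * a + t * b).
Proof.
move=> t; apply: cvgD; apply: cvgM; try exact: cvg_cst; last exact: cvg_id.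
by apply: cvgB; [exact: cvg_cst|exact: cvg_id].
Qed.

End RealFunctions.

Section Intervals.
Local Open Scope ring_scope.

Lemma monotone_intervals (R : numDomainType) (p : nat) (h : 'I_p -> R) (i i' k k' : 'I_p) (s : R) :
  (forall t t', (h t <= h t') = (t <= t')%N) ->
  (i <= i' <= i.+1)%N -> (k <= k' <= k.+1)%N ->
  h i <= s <= h i' -> h k <= s <= h k' ->
  (i = k /\ i' = k') \/ exists z, [/\ (z == i) || (z == i'), (z == k) || (z == k') & s = h z].
Proof.
move=> hm; wlog ik : i i' k k' / (i <= k)%N.
  move=> W hi hk si sk; case/orP: (leq_total i k) => h1; first exact: W.
  case: (W _ _ _ _ h1 hk hi sk si) => [[-> ->]|[z [h2 h3 h4]]]; first by left.
  by right; exists z.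
move=> hi hk /andP[s1 s2] /andP[s3 s4].
have ki' : (k <= i')%N by rewrite -hm (le_trans s3).
have [E|ne] := eqVneq i k.
  subst k; have [E|ne'] := eqVneq i' k'; first by left; split.
  right; exists i; rewrite eqxx; split=> //.
  have [E|E] : i' = i \/ k' = i.
    have h1 : i' != k' :> nat by [].
    have [h2|h2] := eqVneq (i' : nat) i; [left|right]; apply: val_inj => //=; lia.
  - by subst i'; apply/eqP; rewrite eq_le s1 s2.
  - by subst k'; apply/eqP; rewrite eq_le s3 s4.
have ne' : i != k :> nat by [].
have E : i' = k by apply: val_inj => /=; lia.
subst i'; right; exists k; rewrite !eqxx orbT; split=> //.
by apply/eqP; rewrite eq_le s2 s3.
Qed.

End Intervals.

(** * A planar drawing from a layout of the feet *)

Section ModelDrawing.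
Local Open Scope ring_scope.
Variables (R : realType) (m n : nat) (S : {set 'I_m * 'I_n}) (al ar : R).
Variables (dd : 'I_m -> R) (foot : 'I_m -> 'I_n -> R).
Hypotheses (al0 : 0 < al) (ar0 : 0 < ar).
Hypothesis dd_mono : forall i i', (dd i <= dd i') = (i <= i')%N.
Hypothesis dd_range : forall i, -1 < dd i < 1.
Hypothesis foot_norm : forall i j, `|foot i j| = j.+1%:R.
Hypothesis placedS : forall i j, (i, j) \in S -> placed al ar (dd i) (foot i j).
Hypothesis inside_mono : forall i j i' j', (i, j) \in S -> (i', j') \in S ->
  inside al ar (foot i j) -> inside al ar (foot i' j') ->
  foot i j < foot i' j' -> (i <= i')%N.
Hypothesis outleft_mono : forall i j i' j', (i, j) \in S -> (i', j') \in S ->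
  outleft al (dd i) (foot i j) -> outleft al (dd i') (foot i' j') ->
  (i < i')%N -> foot i' j' <= foot i j.
Hypothesis outright_mono : forall i j i' j', (i, j) \in S -> (i', j') \in S ->
  outright ar (dd i) (foot i j) -> outright ar (dd i') (foot i' j') ->
  (i < i')%N -> foot i' j' <= foot i j.

(* [u_i] is drawn at [roof (dd i)], and the rung [u_i v_j] ends at the copy
   [(foot i j, 0)] of [v_j]. *)
Definition vtx := ('I_m + 'I_n)%type.
Implicit Types x y z : vtx.

Definition model_adj x y := match x, y with
  | inl i, inl i' => (i.+1 == i') || (i'.+1 == i)
  | inr j, inr j' => (j.+1 == j') || (j'.+1 == j)
  | inl i, inr j | inr j, inl i => (i, j) \in S end%N.

Definition curve x y (t : R) : R * R := match x, y with
  | inl i, inl i' => roof al ar ((1 - t) * dd i + t * dd i')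
  | inr j, inr j' => ((1 - t) * j.+1%:R + t * j'.+1%:R, 0)
  | inl i, inr j => rung al ar (dd i) (foot i j) t
  | inr j, inl i => rung al ar (dd i) (foot i j) (1 - t) end.

Definition model_pos x : R * R := match x with
  | inl i => fold (roof al ar (dd i)) | inr j => fold (j.+1%:R, 0) end.

Lemma fold_foot i j : fold (foot i j, 0) = model_pos (inr j).
Proof. by rewrite /= /fold /= -(foot_norm i j) real_normK ?num_real // !mulr0. Qed.

Lemma foot_eq i j i' j' : foot i j = foot i' j' \/ foot i j = - foot i' j' -> j = j'.
Proof.
move=> H; have : `|foot i j| = `|foot i' j'| by case: H => ->; rewrite ?normrN.
by rewrite !foot_norm => /eqP; rewrite eqr_nat eqSS => /eqP/val_inj.
Qed.

Lemma dd_inj : injective dd.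
Proof. by move=> i i' E; apply/val_inj/eqP; rewrite eqn_leq -!dd_mono E lexx. Qed.

Lemma curve_rev x y t : curve x y (1 - t) = curve y x t.
Proof.
by case: x y => [i|j] [i'|j'] /=; rewrite ?subKr //; [congr (roof _ _ _)|congr pair]; ring.
Qed.

Lemma curve0 x y : fold (curve x y 0) = model_pos x.
Proof.
case: x y => [i|j] [i'|j'] /=; rewrite ?subr0 ?mul1r ?mul0r ?addr0 ?rung_0 ?rung_1 //.
by rewrite fold_foot.
Qed.

Lemma curve1 x y : fold (curve x y 1) = model_pos y.
Proof. by rewrite -[1]subr0 curve_rev curve0. Qed.

(** Along a rung the height varies strictly, the roof is injective and off the axis, and the floor
    uses positive abscissas only; so [fold] glues no two points of one curve. *)
Lemma curve_inj x y (t t' : R) : model_adj x y -> 0 <= t <= 1 -> 0 <= t' <= 1 ->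
  fold (curve x y t) = fold (curve x y t') -> t = t'.
Proof.
have rinj i b (s s' : R) : 0 <= s <= 1 -> 0 <= s' <= 1 ->
    fold (rung al ar (dd i) b s) = fold (rung al ar (dd i) b s') -> s = s'.
  move=> hs hs' /fold_inj; rewrite !rung_ge0 // => /(_ isT isT) H.
  have := roof_gt0 al ar (dd_range i) => y0.
  have : (rung al ar (dd i) b s).2 = (rung al ar (dd i) b s').2 by case: H => [->//|[-> ->]].
  rewrite /rung /seg_point /= in y0 *; rewrite mulr0 mulr0 !addr0 => /mulIf.
  by rewrite gt_eqF // => /(_ isT); lra.
have range i i' (s : R) : 0 <= s <= 1 -> -1 < (1 - s) * dd i + s * dd i' < 1.
  move=> /andP[s0 s1]; have /andP[a1 a2] := dd_range i; have /andP[b1 b2] := dd_range i'.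
  have [ab|/ltW ab] := leP (dd i) (dd i').
    have h1 : 0 <= s * (dd i' - dd i) by rewrite mulr_ge0 // subr_ge0.
    have h2 : 0 <= (1 - s) * (dd i' - dd i) by rewrite mulr_ge0 // subr_ge0.
    by apply/andP; split; lra.
  have h1 : 0 <= s * (dd i - dd i') by rewrite mulr_ge0 // subr_ge0.
  have h2 : 0 <= (1 - s) * (dd i - dd i') by rewrite mulr_ge0 // subr_ge0.
  by apply/andP; split; lra.
case: x y => [i|j] [i'|j'] /= xy ht ht'.
- move=> /fold_inj; rewrite !ltW ?roof_gt0 ?range // => /(_ isT isT) [/roof_inj|[E _ _]].
    move=> /(_ al0 ar0) E; have ne : dd i' - dd i != 0.
      by rewrite subr_eq0 (inj_eq dd_inj); apply/eqP => ii; move: xy; rewrite ii; lia.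
    by apply: (mulIf ne); lra.
  have := roof_gt0 al ar (range i i' t ht); by rewrite E ltxx.
- exact: rinj.
- move=> /rinj H; suff : 1 - t = 1 - t' by lra.
  by apply: H; lra.
- move=> /fold_inj; rewrite lexx => /(_ isT isT) H.
  have ne : j'.+1%:R - j.+1%:R != 0 :> R.
    by rewrite subr_eq0 eqr_nat; lia.
  have p (s : R) : 0 <= s <= 1 -> 0 < (1 - s) * j.+1%:R + s * j'.+1%:R.
    by move=> /andP[s0 s1]; have := ltr0Sn R j; have := ltr0Sn R j'; nra.
  have P := p t ht; have P' := p t' ht'.
  by apply: (mulIf ne); case: H => [[H]|[_ _ /= H]]; lra.
Qed.

(* Degenerate cells ([i = i'] or [j = j']) are the vertices. *)
Variant cell (E : {set vtx}) (w : R * R) : Prop :=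
| RoofCell (i i' : 'I_m) (s : R) of E = [set inl i; inl i']%SET & (i <= i' <= i.+1)%N
    & dd i <= s <= dd i' & w = roof al ar s
| FloorCell (j j' : 'I_n) (s : R) of E = [set inr j; inr j']%SET & (j <= j' <= j.+1)%N
    & j.+1%:R <= s <= j'.+1%:R & w = (s, 0)
| RungCell (i : 'I_m) (j : 'I_n) (t : R) of E = [set inl i; inr j]%SET & (i, j) \in S
    & 0 <= t <= 1 & w = rung al ar (dd i) (foot i j) t.

(** Allowing [x == y] turns each vertex into a constant curve, so that vertices need no separate
    treatment. *)
Lemma curve_cell x y (t : R) : model_adj x y || (x == y) -> 0 <= t <= 1 ->
  cell [set x; y]%SET (curve x y t).
Proof.
have conv (p : nat) (h : 'I_p -> R) (k k' : 'I_p) (s : R) :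
    (forall q q', (h q <= h q') = (q <= q')%N) -> (k <= k')%N ->
    0 <= s <= 1 -> h k <= (1 - s) * h k + s * h k' <= h k'.
  by move=> hm; rewrite -hm => kk /andP[s0 s1]; apply/andP; split; nra.
have f_mono (q q' : 'I_n) : (q.+1%:R <= q'.+1%:R :> R) = (q <= q')%N by rewrite ler_nat.
move=> xy ht; have ht' : 0 <= 1 - t <= 1 by lra.
case: x y xy => [i|j] [i'|j']; rewrite /= ?orbF => xy.
- have [ii|ii] := leqP i i'.
    apply: (@RoofCell _ _ i i' ((1 - t) * dd i + t * dd i')) => //; last exact: conv.
    by case/orP: xy => [|/eqP[->]]; lia.
  apply: (@RoofCell _ _ i' i ((1 - t) * dd i + t * dd i')) => //; first exact: finset.setUC.
    by case/orP: xy => [|/eqP[->]]; lia.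
  by have := conv _ _ _ _ _ dd_mono (ltnW ii) ht'; rewrite subKr addrC.
- exact: (@RungCell _ _ i j' t).
- by apply: (@RungCell _ _ i' j (1 - t)) => //; exact: finset.setUC.
- have [ii|ii] := leqP j j'.
    apply: (@FloorCell _ _ j j' ((1 - t) * j.+1%:R + t * j'.+1%:R)) => //.
      by case/orP: xy => [|/eqP[->]]; lia.
    exact: (conv _ _ _ _ _ f_mono).
  apply: (@FloorCell _ _ j' j ((1 - t) * j.+1%:R + t * j'.+1%:R)) => //; first exact: finset.setUC.
    by case/orP: xy => [|/eqP[->]]; lia.
  by have := conv _ _ _ _ _ f_mono (ltnW ii) ht'; rewrite subKr addrC.
Qed.

Definition meet_ok (E E' : {set vtx}) (w : R * R) :=
  E = E' \/ exists z, [/\ z \in E, z \in E' & fold w = model_pos z].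

Lemma meet_okC E E' w w' : fold w = fold w' -> meet_ok E' E w' -> meet_ok E E' w.
Proof.
by move=> ww [->|[z [zE zE' wz]]]; [left|right; exists z; rewrite ww].
Qed.

(** Rungs of one class are ordered by the monotonicity hypotheses; rungs of different classes are
    separated by the line of a slope. *)
Lemma rungs_position i j i' j' : (i, j) \in S -> (i', j') \in S ->
  let ord := ordered al ar (dd i) (foot i j) (dd i') (foot i' j') in
  let ord' := ordered al ar (dd i') (foot i' j') (dd i) (foot i j) in
  let out := outleft al (dd i) (foot i j) &&
      (inside al ar (foot i' j') || outright ar (dd i') (foot i' j')) ||
    outright ar (dd i) (foot i j) && inside al ar (foot i' j') in
  let out' := outleft al (dd i') (foot i' j') &&
      (inside al ar (foot i j) || outright ar (dd i) (foot i j)) ||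
    outright ar (dd i') (foot i' j') && inside al ar (foot i j) in
  [\/ ord, ord', out | out'].
Proof.
move=> h h' /=; have H (P Q : Prop) : ordered al ar (dd i) (foot i j) (dd i') (foot i' j') \/
    ordered al ar (dd i') (foot i' j') (dd i) (foot i j) ->
  [\/ ordered al ar (dd i) (foot i j) (dd i') (foot i' j'),
    ordered al ar (dd i') (foot i' j') (dd i) (foot i j), P | Q].
  by case=> ?; [constructor 1|constructor 2].
have := placedS h; have := placedS h'; case/or3P => hb' /or3P[] hb.
- apply: H; case: (ltgtP (foot i j) (foot i' j')) => bb.
  + by left; constructor 1; split=> //; [exact: ltW|rewrite dd_mono; exact: inside_mono bb].
  + by right; constructor 1; split=> //; [exact: ltW|rewrite dd_mono; exact: inside_mono bb].
  + by case/orP: (leq_total i i') => ii; [left|right]; constructor 1; split;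
      rewrite ?bb ?dd_mono.
- by constructor 3; rewrite hb hb'.
- by constructor 3; rewrite hb hb' orbT.
- by constructor 4; rewrite hb hb'.
- apply: H; case: (ltngtP i i') => ii.
  + by left; constructor 2; split=> //; [exact: outleft_mono ii|rewrite dd_mono ltnW].
  + by right; constructor 2; split=> //; [exact: outleft_mono ii|rewrite dd_mono ltnW].
  + have {}ii : i = i' by apply: val_inj.
    by case/orP: (le_total (foot i' j') (foot i j)) => bb; [left|right]; constructor 2;
      split; rewrite // ii.
- by constructor 4; rewrite hb hb' orbT.
- by constructor 4; rewrite hb hb' orbT.
- by constructor 3; rewrite hb hb' orbT.
- apply: H; case: (ltngtP i i') => ii.
  + by left; constructor 3; split=> //; [exact: outright_mono ii|rewrite dd_mono ltnW].
  + by right; constructor 3; split=> //; [exact: outright_mono ii|rewrite dd_mono ltnW].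
  + have {}ii : i = i' by apply: val_inj.
    by case/orP: (le_total (foot i' j') (foot i j)) => bb; [left|right]; constructor 3;
      split; rewrite // ii.
Qed.

Lemma rung_rung_meet i j t i' j' t' : (i, j) \in S -> (i', j') \in S ->
  0 <= t <= 1 -> 0 <= t' <= 1 ->
  rung al ar (dd i) (foot i j) t = rung al ar (dd i') (foot i' j') t' ->
  [\/ i = i' /\ j = j', [/\ t = 1, t' = 1 & j = j'] | [/\ t = 0, t' = 0 & i = i']].
Proof.
move=> h h' ht ht' E.
have : [\/ dd i = dd i' /\ foot i j = foot i' j', [/\ t = 1, t' = 1 & foot i j = foot i' j'] |
    [/\ t = 0, t' = 0 & dd i = dd i']].
  case: (rungs_position h h') => [c|c|/orP[]/andP[c c']|/orP[]/andP[c c']].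
  - exact: ordered_meets E.
  - case: (ordered_meets (dd_range i') (dd_range i) ht' ht c (esym E)) => [[-> ->]|[-> -> ->]|[-> -> ->]];
    by [constructor 1|constructor 2|constructor 3].
  - by constructor 3; exact: outleft_meets E.
  - by constructor 3; exact: outright_meets E.
  - by constructor 3; have [-> -> ->] : [/\ t' = 0, t = 0 & dd i' = dd i] by exact: outleft_meets (esym E).
  - by constructor 3; have [-> -> ->] : [/\ t' = 0, t = 0 & dd i' = dd i] by exact: outright_meets (esym E).
case=> [[/dd_inj-> bb]|[-> -> bb]|[-> -> /dd_inj->]].
- by constructor 1; split=> //; apply: foot_eq; left; exact: bb.
- by constructor 2; split=> //; apply: foot_eq; left; exact: bb.
- by constructor 3.
Qed.

Lemma span_range i i' (s : R) : dd i <= s <= dd i' -> -1 < s < 1.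
Proof. by have /andP[] := dd_range i; have /andP[] := dd_range i'; lra. Qed.

Lemma roof_meets_floor i i' s s' : dd i <= s <= dd i' ->
  fold (roof al ar s) <> fold (s', 0).
Proof.
move=> hs /fold_inj; have := roof_gt0 al ar (span_range hs) => s0.
by rewrite (ltW s0) lexx => /(_ isT isT) [e|[e _ _]]; rewrite e /= ltxx in s0.
Qed.

Lemma between_consecutive (p : nat) (h : 'I_p -> R) (i i' k : 'I_p) :
  (forall t t', (h t <= h t') = (t <= t')%N) -> (i <= i' <= i.+1)%N ->
  h i <= h k <= h i' -> (k == i) || (k == i').
Proof. by move=> hm; rewrite !hm -!val_eqE /=; lia. Qed.

Lemma roof_meets_rung (i i' : 'I_m) s k j t : (i <= i' <= i.+1)%N -> dd i <= s <= dd i' ->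
  (k, j) \in S -> 0 <= t <= 1 ->
  fold (roof al ar s) = fold (rung al ar (dd k) (foot k j) t) ->
  meet_ok [set inl i; inl i']%SET [set inl k; inr j]%SET (roof al ar s).
Proof.
move=> ii hs kj ht /fold_inj; have := roof_gt0 al ar (span_range hs) => s0.
rewrite (ltW s0) rung_ge0 // => /(_ isT isT) [e|[e _ _]]; last by rewrite e ltxx in s0.
have [_ sk] := rung_meets_roof al0 ar0 ht (placedS kj) (esym e); subst s.
right; exists (inl k); rewrite !inE eqxx; split=> //.
exact: (between_consecutive dd_mono ii).
Qed.

Lemma natr_mono (p : nat) (q q' : 'I_p) : (q.+1%:R <= q'.+1%:R :> R) = (q <= q')%N.
Proof. by rewrite ler_nat. Qed.

(** A rung reaches the axis only at its foot, and [fold] sends either copy of the foot to the same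
    vertex. *)
Lemma floor_meets_rung (j j' : 'I_n) s k l t : (j <= j' <= j.+1)%N ->
  j.+1%:R <= s <= j'.+1%:R -> 0 <= t <= 1 ->
  fold (s, 0) = fold (rung al ar (dd k) (foot k l) t) ->
  meet_ok [set inr j; inr j']%SET [set inl k; inr l]%SET (s, 0).
Proof.
move=> jj hs ht E; have t1 : t = 1.
  apply: (@rung_foot R al ar (dd k) (foot k l)) => //.
  move/fold_inj: E; rewrite lexx rung_ge0 // => /(_ isT isT) [<-//|[_ -> _]//].
move: E; rewrite t1 rung_1 fold_foot => E.
have sl : s = l.+1%:R.
  move/fold_inj: (E); rewrite /= lexx => /(_ isT isT) [[->//]|[_ _ /= e]].
  by have := ltr0Sn R j; have := ltr0Sn R l; lra.
right; exists (inr l); rewrite !inE eqxx orbT; split=> //.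
by apply: (between_consecutive (@natr_mono n) jj); rewrite -sl.
Qed.

Lemma cells_meet E E' w w' : cell E w -> cell E' w' -> fold w = fold w' -> meet_ok E E' w.
Proof.
case=> [i i' s -> ii hs ->|j j' s -> jj hs ->|i j t -> ij ht ->].
- case=> [k k' s' -> kk hs' ->|l l' s' -> ll hs' ->|k l t' -> kl ht' ->] e.
  + have s0 := roof_gt0 al ar (span_range hs); have s'0 := roof_gt0 al ar (span_range hs').
    have ss : s = s'.
      have [/roof_inj|[y0 _ _]] := fold_inj (ltW s0) (ltW s'0) e; first exact.
      by rewrite y0 ltxx in s0.
    subst s'; case: (monotone_intervals dd_mono ii kk hs hs') => [[-> ->]|[q [h1 h2 ->]]].
      by left.
    by right; exists (inl q); rewrite !inE.
  + by have := roof_meets_floor hs e.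
  + exact: roof_meets_rung kl ht' e.
- case=> [k k' s' -> kk hs' ->|l l' s' -> ll hs' ->|k l t' -> kl ht' ->] e.
  + by have := roof_meets_floor hs' (esym e).
  + have ss : s = s'.
      have [[->//]|[_ _ /= f]] := @fold_inj R (s, 0) (s', 0) (lexx 0) (lexx 0) e.
      by have := ltr0Sn R j; have := ltr0Sn R l; lra.
    subst s'; case: (monotone_intervals (@natr_mono n) jj ll hs hs') => [[-> ->]|[q [h1 h2 ->]]].
      by left.
    by right; exists (inr q); rewrite !inE.
  + exact: floor_meets_rung ht' e.
- case=> [k k' s' -> kk hs' ->|l l' s' -> ll hs' ->|k l t' -> kl ht' ->] e.
  + by apply: (meet_okC e); apply: roof_meets_rung ij ht (esym e).
  + by apply: (meet_okC e); apply: floor_meets_rung ht (esym e).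
  + have [/rung_rung_meet|[y0 y'0 f]] :=
      fold_inj (rung_ge0 _ _ _ (dd_range i) ht) (rung_ge0 _ _ _ (dd_range k) ht') e.
      case=> // [[-> ->]|[t1 _ jl]|[t0 _ ik]]; first by left.
        right; exists (inr j); rewrite !inE !eqxx jl eqxx !orbT; split=> //.
        by rewrite t1 rung_1 fold_foot.
      right; exists (inl i); rewrite !inE !eqxx ik eqxx; split=> //.
      by rewrite t0 rung_0.
    (* Here [fold] glues two points of the axis, so the feet are opposite copies of one vertex of
       the second path. *)
    have t1 := rung_foot (dd_range i) y0; have t'1 := rung_foot (dd_range k) y'0.
    move: f; rewrite t1 t'1 !rung_1 /= => f.
    have jl : j = l by apply: (@foot_eq i j k l); right.
    right; exists (inr j); rewrite !inE !eqxx jl eqxx !orbT; split=> //.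
    exact: fold_foot.
Qed.

Lemma curves_meet x y x' y' (t t' : R) :
  model_adj x y || (x == y) -> model_adj x' y' || (x' == y') -> 0 <= t <= 1 -> 0 <= t' <= 1 ->
  fold (curve x y t) = fold (curve x' y' t') ->
  meet_ok [set x; y]%SET [set x'; y']%SET (curve x y t).
Proof.
by move=> xy xy' ht ht' e; apply: (cells_meet (curve_cell xy ht) (curve_cell xy' ht') e).
Qed.

(** This is [curves_meet] against the constant curve at [z]. *)
Lemma curve_pos x y z (t : R) : model_adj x y -> 0 <= t <= 1 ->
  fold (curve x y t) = model_pos z -> z \in [set x; y]%SET.
Proof.
move=> xy ht e; have t0 : 0 <= (0 : R) <= 1 by rewrite lexx ler01.
have h : model_adj x y || (x == y) by rewrite xy.
have hz : model_adj z z || (z == z) by rewrite eqxx orbT.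
have [->|[z' [z'xy z'z _]]] := curves_meet h hz ht t0 (etrans e (esym (curve0 z z))).
  by rewrite !inE eqxx.
by move: z'z; rewrite !inE orbb => /eqP <-; move: z'xy; rewrite !inE.
Qed.

Lemma model_pos_inj : injective model_pos.
Proof.
move=> x y e; have t0 : 0 <= (0 : R) <= 1 by rewrite lexx ler01.
have h z : model_adj z z || (z == z) by rewrite eqxx orbT.
have e' : fold (curve x x 0) = fold (curve y y 0) by rewrite !curve0.
have [/setP/(_ x)|[z []]] := curves_meet (h x) (h y) t0 t0 e'.
  by rewrite !inE eqxx !orbb => /esym/eqP.
by rewrite !inE !orbb => /eqP-> /eqP->.
Qed.

Lemma continuous_curve (x y : 'I_m + 'I_n) :
  continuous (fun t : R => fold (curve x y t)).
Proof.
have roofc d d' : continuous (fun t : R => fold (roof al ar ((1 - t) * d + t * d'))).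
  have c := @continuous_mix R d d'; have cn : continuous (fun t : R => `|(1 - t) * d + t * d'|).
    by move=> t; apply: cvg_norm; exact: c.
  apply: continuous_fold => t.
    by apply: cvgD; apply: cvgM; try exact: cvg_cst; [exact: c|exact: cn].
  by apply: cvgB; [exact: cvg_cst|exact: cn].
have rungc d b : continuous (fun t : R => fold (rung al ar d b t)).
  by apply: continuous_fold; exact: continuous_mix.
case: x y => [i|j] [i'|j'] /=.
- exact: roofc.
- exact: rungc.
- move=> t; apply: (@continuous_comp R R (R * R)%type (fun s : R => 1 - s)
    (fun s => fold (rung al ar (dd i') (foot i' j) s)) t); last exact: rungc.
  by apply: cvgB; [exact: cvg_cst|exact: cvg_id].
- apply: continuous_fold; [exact: continuous_mix|exact: cst_continuous].
Qed.

Local Open Scope classical_set_scope.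

Lemma planar_of_layout (G : sgraph) (u : 'I_m -> G) (v : 'I_n -> G) :
  generalized_ladder u v -> rungs u v = S -> planar R G.
Proof.
move=> hG SE.
have [D [Du Dv DK]] := ladder_decode hG; have [_ _ uadj vadj] := hG.
have Dinj : injective D.
  by move=> x y xy; rewrite (DK x) (DK y) xy.
have Dadj (x y : G) : adj x y -> model_adj (D x) (D y).
  rewrite {1}(DK x) {1}(DK y); case: (D x) => [i|j]; case: (D y) => [i'|j'] //=.
  - by rewrite uadj.
  - by rewrite -SE inE.
  - by rewrite -SE inE adj_sym.
  - by rewrite vadj.
pose c (x y : G) := curve (D x) (D y).
(* A set of two vertices has no direction, so the arc collects the curves in both; by [curve_rev]
   their images agree. *)
pose arc (E : {set G}) : set (R * R) := [set w | exists (x y : G) t,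
  [/\ adj x y, E = [set x; y]%SET, 0 <= t <= 1 & w = fold (c x y t)]].
have imD (x y x' y' : G) : [set D x; D y]%SET = [set D x'; D y']%SET ->
    [set x; y]%SET = [set x'; y']%SET.
  by move=> /setP H; apply/setP => z; have := H (D z); rewrite !inE !(inj_eq Dinj).
exists (fun x : G => model_pos (D x)), arc; split.
- exact/(inj_comp _ Dinj)/(@model_pos_inj).
- move=> x y xy; exists (fun t => fold (c x y t)); split.
  + exact/continuous_subspaceT/continuous_curve.
  + move=> t t'; rewrite !inE /= => ht ht'; exact: curve_inj (Dadj _ _ xy) ht ht'.
  + exact: curve0.
  + exact: curve1.
  + apply/seteqP; split=> [w [t /= ht <-]|w [x' [y' [t [xy' E ht ->]]]]].
      by exists x, y, t.
    have [[-> ->]|[-> ->]] : (x' = x /\ y' = y) \/ (x' = y /\ y' = x).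
      have /setP H := E; move: (H x) (H y) (H x'); rewrite !inE !eqxx /= ?orbT.
      move=> /esym/orP[]/eqP hx /esym/orP[]/eqP hy /orP[]/eqP hx'; subst; auto.
      all: try by rewrite adj_irr in xy.
      all: try by rewrite adj_irr in xy'.
    * by exists t.
    * exists (1 - t); first by rewrite /= in_itv /=; lra.
      by rewrite /c curve_rev.
- move=> E z _ [x [y [t [xy -> ht e]]]].
  have := @curve_pos (D x) (D y) (D z) t (Dadj _ _ xy) ht (esym e).
  by rewrite !inE !(inj_eq Dinj).
- move=> E E' _ _ EE w [[x [y [t [xy Exy ht e]]]] [x' [y' [t' [xy' Exy' ht' e']]]]].
  have h : model_adj (D x) (D y) || (D x == D y) by rewrite Dadj.
  have h' : model_adj (D x') (D y') || (D x' == D y') by rewrite Dadj.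
  have := @curves_meet _ _ _ _ _ _ h h' ht ht' (etrans (esym e) e').
  case=> [/imD F|[z [zE zE' ez]]]; first by case: EE; rewrite Exy Exy'.
  move: zE zE'; rewrite !inE => hz hz'.
  have [z0 Dz] : exists z0 : G, z = D z0.
    by case/orP: hz => /eqP->; [exists x|exists y].
  exists z0; last by rewrite e -Dz.
  by rewrite /= !inE Exy Exy' !inE -!(inj_eq Dinj) -Dz hz hz'.
Qed.

End ModelDrawing.

(** * Distribution of the rungs *)

Section Quadrants.
Variables (m n : nat) (S : {set 'I_m * 'I_n}).
Implicit Types e f : 'I_m * 'I_n.

(** Compass directions in the grid with the index on the first path as horizontal and that on the
    second as vertical coordinate. *)
Definition nw e := [exists f in S, (f.1 < e.1) && (e.2 < f.2)].
Definition ne e := [exists f in S, (e.1 < f.1) && (e.2 < f.2)].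
Definition se e := [exists f in S, (e.1 < f.1) && (f.2 < e.2)].
Definition sw e := [exists f in S, (f.1 < e.1) && (f.2 < e.2)].

Lemma quadrant_free (P : 'I_m * 'I_n -> bool) f :
  ~~ [exists g in S, P g] -> f \in S -> ~~ P f.
Proof. by move=> H fS; apply: contra H => Pf; apply/existsP; exists f; rewrite fS. Qed.

(** [iT] divides rungs with free [nw] from those with free [ne], [iB] free [sw] from free [se], [jA]
    free [sw] from free [nw], and [jB] free [se] from free [ne]. A rung with several free quadrants
    joins a class that its position fits. *)
Lemma quadrant_thresholds :
  (forall e, e \in S -> [|| ~~ nw e, ~~ ne e, ~~ se e | ~~ sw e]) ->
  exists iT iB jA jB : nat, forall e, e \in S ->
    [|| [&& ~~ nw e, e.1 <= iT & jA <= e.2], [&& ~~ ne e, iT <= e.1 & jB <= e.2],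
        [&& ~~ se e, iB <= e.1 & e.2 < jB] | [&& ~~ sw e, e.1 <= iB & e.2 < jA]].
Proof.
move=> H.
(* Each threshold is the least one admitting the rungs forced to its lower side, those with one of
   the two quadrants free and the other occupied. Successors occur where the required inequality is
   strict. *)
exists (\max_(f in S | ~~ nw f && ne f) f.1), (\max_(f in S | ~~ sw f && se f) f.1).
exists (\max_(f in S | ~~ sw f && nw f) f.2.+1), (\max_(f in S | ~~ se f && ne f) f.2.+1).
move=> [e1 e2] eS; set e : 'I_m * 'I_n := (e1, e2).
set iT := \max_(f in S | _) f.1; set iB := \max_(f in S | _) f.1.
set jA := \max_(f in S | _) _; set jB := \max_(f in S | _) _.
have T1 : ~~ nw e -> ne e -> e.1 <= iT.
  by move=> h1 h2; apply: (@leq_bigmax_cond _ _ (fun f : 'I_m * 'I_n => f.1 : nat)); rewrite eS h1.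
have B1 : ~~ sw e -> se e -> e.1 <= iB.
  by move=> h1 h2; apply: (@leq_bigmax_cond _ _ (fun f : 'I_m * 'I_n => f.1 : nat)); rewrite eS h1.
have A1 : ~~ sw e -> nw e -> e.2 < jA.
  by move=> h1 h2; apply: (@leq_bigmax_cond _ _ (fun f : 'I_m * 'I_n => f.2.+1)); rewrite eS h1.
have D1 : ~~ se e -> ne e -> e.2 < jB.
  by move=> h1 h2; apply: (@leq_bigmax_cond _ _ (fun f : 'I_m * 'I_n => f.2.+1)); rewrite eS h1.
(* Were [e] left of [f], then [e] would be no higher as [nw] of [f] is free, and [g] would lie in
   the [ne] quadrant of [e]. *)
have T2 : ~~ ne e -> iT <= e.1.
  move=> h; apply/bigmax_leqP => -[f1 f2] /and3P[fS h1 /exists_inP[[g1 g2] gS /= h2]].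
  have := quadrant_free h fS; have := quadrant_free h gS.
  have := quadrant_free h1 eS; rewrite /= => ???; lia.
have B2 : ~~ se e -> iB <= e.1.
  move=> h; apply/bigmax_leqP => -[f1 f2] /and3P[fS h1 /exists_inP[[g1 g2] gS /= h2]].
  have := quadrant_free h fS; have := quadrant_free h gS.
  have := quadrant_free h1 eS; rewrite /= => ???; lia.
(* Were [e] no higher than [f], the rung [k], which is not in the [sw] quadrant of [f], would force
   [e] to the right of [f], and [g] would lie in the [nw] quadrant of [e]. *)
have A2 : ~~ nw e -> sw e -> jA <= e.2.
  move=> h /exists_inP[[k1 k2] kS /= h3].
  apply/bigmax_leqP => -[f1 f2] /and3P[fS h1 /exists_inP[[g1 g2] gS /= h2]].
  have := quadrant_free h gS; have := quadrant_free h1 kS; rewrite /= => ??; lia.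
have D2 : ~~ ne e -> se e -> jB <= e.2.
  move=> h /exists_inP[[k1 k2] kS /= h3].
  apply/bigmax_leqP => -[f1 f2] /and3P[fS h1 /exists_inP[[g1 g2] gS /= h2]].
  have := quadrant_free h gS; have := quadrant_free h1 kS; rewrite /= => ??; lia.
move: (H e eS) T1 B1 A1 D1 T2 B2 A2 D2.
by case: (nw e); case: (ne e); case: (se e); case: (sw e) => //=; lia.
Qed.

End Quadrants.

(** * Layout of the feet from the thresholds *)

Section Layout.
Local Open Scope ring_scope.
Variables (R : realType) (m n : nat) (S : {set 'I_m * 'I_n}) (iT iB jA jB : nat).
Hypothesis cover : forall e, e \in S ->
  [|| [&& ~~ nw S e, e.1 <= iT & jA <= e.2], [&& ~~ ne S e, iT <= e.1 & jB <= e.2],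
      [&& ~~ se S e, iB <= e.1 & e.2 < jB] | [&& ~~ sw S e, e.1 <= iB & e.2 < jA]]%N.

(* The apex of the roof is at [iT]. Seen from the origin, the left slope reaches
   the ground just before the left copy of [v_jA], and the right slope just before
   the right copy of [v_jB]; the rungs below the roof go left up to [iB] and right
   from [iB] on. *)
Definition goes_left (e : 'I_m * 'I_n) :=
  ([&& ~~ nw S e, e.1 <= iT & jA <= e.2] || [&& ~~ sw S e, e.1 <= iB & e.2 < jA])%N.

Definition foot (i : 'I_m) (j : 'I_n) : R :=
  if goes_left (i, j) then - j.+1%:R else j.+1%:R.

(** The denominator exceeds every [i + iT], which keeps all values strictly between -1 and 1. *)
Definition abscissa (i : 'I_m) : R := (i%:R - iT%:R) / (m + iT).+1%:R.

Lemma foot_kind i j : (i, j) \in S ->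
  [\/ [/\ foot i j = - (j%:R + 1), jA%:R <= j%:R :> R, ~~ nw S (i, j) & (i <= iT)%N],
      [/\ foot i j = j%:R + 1, jB%:R <= j%:R :> R, ~~ ne S (i, j) & (iT <= i)%N],
      [/\ foot i j = j%:R + 1, j%:R + 1 <= jB%:R :> R, ~~ se S (i, j) & (iB <= i)%N] |
      [/\ foot i j = - (j%:R + 1), j%:R + 1 <= jA%:R :> R, ~~ sw S (i, j) & (i <= iB)%N]].
Proof.
move=> /cover; rewrite /foot /goes_left !natr1 !ler_nat.
case: ifP => [/orP[]/and3P[h1 h2 h3] _|].
- by constructor 1.
- by constructor 4.
move=> /norP[/negbTE-> /negbTE->]; rewrite orbF /= => /orP[]/and3P[h1 h2 h3].
- by constructor 2.
- by constructor 3.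
Qed.

Lemma abscissa_mono (i i' : 'I_m) : (abscissa i <= abscissa i') = (i <= i')%N.
Proof. by rewrite /abscissa ler_pM2r ?invr_gt0 ?ltr0Sn // lerD2r ler_nat. Qed.

Lemma abscissa_range (i : 'I_m) : -1 < abscissa i < 1.
Proof.
rewrite /abscissa ltr_pdivrMr ?ltr_pdivlMr ?ltr0Sn // mulN1r mul1r -natr1 natrD.
have : i.+1%:R <= m%:R :> R by rewrite ler_nat.
rewrite -natr1; have := ler0n R i; have := ler0n R iT; lra.
Qed.

Lemma abscissa_le0 (i : 'I_m) : (i <= iT)%N -> abscissa i <= 0.
Proof. by move=> h; rewrite /abscissa pmulr_lle0 ?invr_gt0 ?ltr0Sn // subr_le0 ler_nat. Qed.

Lemma abscissa_ge0 (i : 'I_m) : (iT <= i)%N -> 0 <= abscissa i.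
Proof. by move=> h; rewrite /abscissa pmulr_lge0 ?invr_gt0 ?ltr0Sn // subr_ge0 ler_nat. Qed.

Lemma planar_of_thresholds (G : sgraph) (u : 'I_m -> G) (v : 'I_n -> G) :
  generalized_ladder u v -> rungs u v = S -> planar R G.
Proof.
(* The foot of index [j], counted from 0, is at distance [j + 1] from the origin, so the half places
   each slope's end just before the foot of index [jA] or [jB]. *)
pose al : R := jA%:R + 2^-1; pose ar : R := jB%:R + 2^-1.
have A0 := ler0n R jA; have B0 := ler0n R jB.
apply: (@planar_of_layout R m n S al ar abscissa foot).
- by rewrite /al; lra.
- by rewrite /ar; lra.
- exact: abscissa_mono.
- exact: abscissa_range.
- by move=> i j; rewrite /foot; case: ifP; rewrite ?normrN normr_nat.
- move=> i j /foot_kind; rewrite /placed /inside /outleft /outright /al /ar.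
  have j0 := ler0n R j.
  case=> -[-> h _ hi].
  + by apply/or3P; constructor 2; rewrite abscissa_le0 // andbT; lra.
  + by apply/or3P; constructor 3; rewrite abscissa_ge0 // andbT; lra.
  + by apply/or3P; constructor 1; apply/andP; split; lra.
  + by apply/or3P; constructor 1; apply/andP; split; lra.
(* Two inside rungs with feet on the right are ordered by a free [se], two with feet on the left by
   a free [sw], and a left one precedes a right one because [iB] lies between them. *)
- move=> i j i' j' h h'; rewrite /inside /al /ar => /andP[l r] /andP[l' r'] lt.
  have j0 := ler0n R j; have j'0 := ler0n R j'.
  case: (foot_kind h) (foot_kind h') => -[E k q hi] [] [E' k' q' hi'];
    rewrite E in l r lt; rewrite E' in l' r' lt; try lra.
  + have jj : (j < j')%N by rewrite -(ltr_nat R); lra.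
    by have := quadrant_free q' h; rewrite /= jj andbT -leqNgt.
  + exact: leq_trans hi hi'.
  + have jj : (j' < j)%N by rewrite -(ltr_nat R); lra.
    by have := quadrant_free q h'; rewrite /= jj andbT -leqNgt.
(* As [nw] of the rung further right is free, its foot is no nearer to the origin. The right slope
   is symmetric, with [ne] of the rung further left. *)
- move=> i j i' j' h h'; rewrite /outleft /al => /andP[l _] /andP[l' _] ii.
  have j0 := ler0n R j; have j'0 := ler0n R j'.
  case: (foot_kind h) (foot_kind h') => -[E k q hi] [] [E' k' q' hi'];
    rewrite E in l *; rewrite E' in l' *; try lra.
  have := quadrant_free q' h; rewrite /= ii /= -leqNgt -(ler_nat R); lra.
- move=> i j i' j' h h'; rewrite /outright /ar => /andP[l _] /andP[l' _] ii.
  have j0 := ler0n R j; have j'0 := ler0n R j'.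
  case: (foot_kind h) (foot_kind h') => -[E k q hi] [] [E' k' q' hi'];
    rewrite E in l *; rewrite E' in l' *; try lra.
  have := quadrant_free q h'; rewrite /= ii /= -leqNgt -(ler_nat R); lra.
Qed.

End Layout.

(** * The four edge sets as quadrants *)

Section QuadrantSets.
Variables (m n : nat) (G : sgraph) (u : 'I_m -> G) (v : 'I_n -> G).
Let S := rungs u v.

Lemma eq_set0_exists (T : finType) (A S' : {set T}) (P : pred T) :
  (forall x, (x \in A) = (x \in S') && P x) ->
  A = finset.set0 <-> ~~ [exists x in S', P x].
Proof.
move=> AE; split=> [A0|nP].
  by apply/existsPn => x; rewrite -AE A0 inE.
apply/setP => x; rewrite AE [in RHS]inE; apply/negbTE.
by move/existsPn: nP; apply.
Qed.

Lemma se_empty e : (Lup u v e :&: Rdown u v e)%SET = finset.set0 <-> ~~ se S e.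
Proof.
apply: eq_set0_exists => -[i j]; rewrite !inE /lidx /ridx /= !ltnS !ltn_ord /= andbT.
by case: (adj _ _).
Qed.

Lemma ne_empty e : (Lup u v e :&: Rup u v e)%SET = finset.set0 <-> ~~ ne S e.
Proof.
apply: eq_set0_exists => -[i j]; rewrite !inE /lidx /ridx /= !ltnS !ltn_ord /= !andbT.
by case: (adj _ _).
Qed.

Lemma nw_empty e : (Ldown u v e :&: Rup u v e)%SET = finset.set0 <-> ~~ nw S e.
Proof.
apply: eq_set0_exists => -[i j]; rewrite !inE /lidx /ridx /= !ltnS !ltn_ord /= andbT.
by case: (adj _ _).
Qed.

Lemma sw_empty e : (Ldown u v e :&: Rdown u v e)%SET = finset.set0 <-> ~~ sw S e.
Proof.
apply: eq_set0_exists => -[i j]; rewrite !inE /lidx /ridx /= !ltnS /=.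
by case: (adj _ _).
Qed.

End QuadrantSets.

Theorem theorem3 (R : realType) (m n : nat) (hm : 0 < m) (hn : 0 < n)
    (G : sgraph) (u : 'I_m -> G) (v : 'I_n -> G)
    (hG : generalized_ladder u v) :
  planar R G <->
  (forall e : 'I_m * 'I_n, e \in rungs u v ->
     [\/ (Lup u v e :&: Rdown u v e)%SET = finset.set0,
         (Lup u v e :&: Rup u v e)%SET = finset.set0,
         (Ldown u v e :&: Rup u v e)%SET = finset.set0
       | (Ldown u v e :&: Rdown u v e)%SET = finset.set0]).
Proof.
split=> [P e eS|H].
  case: (boolP (se (rungs u v) e)) => [/exists_inP[e1 r1 /andP[a1 b1]]|/se_empty]; last by constructor 1.
  case: (boolP (ne (rungs u v) e)) => [/exists_inP[e2 r2 /andP[a2 b2]]|/ne_empty]; last by constructor 2.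
  case: (boolP (nw (rungs u v) e)) => [/exists_inP[e3 r3 /andP[a3 b3]]|/nw_empty]; last by constructor 3.
  case: (boolP (sw (rungs u v) e)) => [/exists_inP[e4 r4 /andP[a4 b4]]|/sw_empty]; last by constructor 4.
  by case: (crossed_rung_not_planar hG P eS r1 r2 r3 r4).
have [|iT [iB [jA [jB cover]]]] := @quadrant_thresholds m n (rungs u v).
  by move=> e /H[/se_empty->|/ne_empty->|/nw_empty->|/sw_empty->]; rewrite ?orbT.
exact: planar_of_thresholds cover _ _ _ hG erefl.
Qed.
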